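(* Let $\bm{\nu}=(\mu_1,\dots,\mu_{s})$, $s\ge1$, be any Angelesco system or any AT system of positive measures on $\mathbb{R}$ with all moments finite, and let $\bm{K}=(N_1,\dots,N_s)$, where $N_j\in\{1,2,\dots\}\cup\{\infty\}$ is the number of points in $\operatorname{supp}\mu_j$. Let $z_0\in\mathbb{R}$ be such that $z_0$ is not a zero of any type II multiple orthogonal polynomial $P_{\bm{k}}$ of $\bm{\nu}$, and let $\widehat{\bm{\nu}}=((x-z_0)\mu_1,\dots,(x-z_0)\mu_s)$. Then $\widehat{\bm{\nu}}$ is perfect, every type II polynomial $\widehat P_{\bm{k}}$ of $\widehat{\bm{\nu}}$, $\bm{k}\in\mathbb{N}^s_{\bm{K}}$, is real-rooted, and $$(x-z_0)\widehat P_{\bm{k}}(x)\sim P_{\bm{k}}(x),\qquad (x-z_0)\widehat P_{\bm{k}}(x)\sim P_{\bm{k}+\bm{e}_j}(x)$$ for all $\bm{k}$ and $j$ with $\bm{k},\bm{k}+\bm{e}_j\in\mathbb{N}^s_{\bm{K}}$. In particular, this covers the case when $z_0$ belongs to the support of one of the measures, in which case $\widehat{\bm{\nu}}$ is no longer a system of positive measures, so that its perfectness is not trivial.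
   Context: For real polynomials, $p\sim q$ means: all zeros of $p$ and $q$ are pairwise distinct, real and simple, and between every two consecutive zeros of one of the polynomials there lies exactly one zero of the other. Real-rooted means all zeros are real. $\mathbb{N}=\{0,1,2,\dots\}$; $\bm{e}_j$ are the standard unit vectors; $\mathbb{N}^s_{\bm{M}}=\{\bm{n}\in\mathbb{N}^s:n_j\le M_j\ \forall j\}$. For a system of (possibly signed) measures $(\mu_1,\dots,\mu_s)$ and $\bm{n}\in\mathbb{N}^s$, $|\bm{n}|=\sum n_j$, the index $\bm{n}$ is normal if every nonzero polynomial $P$ with $\deg P\le|\bm{n}|$ and $\int P(x)x^p\,d\mu_j=0$ for $0\le p\le n_j-1$, $1\le j\le s$, has degree exactly $|\bm{n}|$; then the unique monic such polynomial is the type II multiple orthogonal polynomial, denoted $P_{\bm{n}}$ for $\bm{\nu}$ and $\widehat P_{\bm{n}}$ for $\widehat{\bm{\nu}}$. The systems $\bm{\nu}$, $\widehat{\bm{\nu}}$ are called perfect if all indices in $\mathbb{N}^s_{\bm{K}}$ are normal for them. Angelesco system: with $\Delta_j$ the convex hull of $\operatorname{supp}\mu_j$ and $\Delta_j^{\mathrm{o}}$ its interior, for all $k\ne j$: $\Delta_k^{\mathrm{o}}\cap\Delta_j^{\mathrm{o}}=\varnothing$, and, if $\mu_k$ and $\mu_j$ are both finitely supported, also $\Delta_k\cap\Delta_j=\varnothing$. AT system: there are an interval $I\subseteq\mathbb{R}$, a positive measure $\mu$ on $I$, and continuous functions $w_1,\dots,w_s$ on $I$, such that $d\mu_j=w_j\,d\mu$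 and, for every multi-index $\bm{n}\neq\bm 0$, the $|\bm{n}|$ functions $x^pw_j(x)$, $0\le p\le n_j-1$, $1\le j\le s$, form a Chebyshev system on $I$ (every nontrivial real linear combination has at most $|\bm{n}|-1$ zeros in $I$).
   Formalization: Repairs for finite supports: Angelesco interiors are relative (no point mass strictly inside another hull); indices k also satisfy |k| ≤ number of points in the union of supports; interlacing is claimed only when k_i ≠ N_i for all i (otherwise the polynomials share zeros). *)

(* Defs.v *)
From HB Require Import structures.
From mathcomp Require Import all_boot all_order all_algebra.
From mathcomp Require Import all_classical all_reals all_analysis.
From mathcomp Require Import complex.

Set Implicit Arguments.
Unset Strict Implicit.
Unset Printing Implicit Defensive.

Import Order.TTheory GRing.Theory Num.Theory.
Import numFieldNormedType.Exports.

Local Open Scope classical_set_scope.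
Local Open Scope card_scope.
Local Open Scope ring_scope.

Section Polynomials.
Context {R : realType}.
Implicit Types p q : {poly R}.

Definition real_rooted p :=
  forall z : R[i], root (map_poly (real_complex R) p) z -> complex.Im z = 0.

Definition zeros_separated p q :=
  forall a b, a < b -> root p a -> root p b ->
    (forall c, a < c < b -> ~~ root p c) ->
    exists! c, (a < c < b) && root q c.

(* The relation p ~ q. *)
Definition interlace p q :=
  [/\ real_rooted p /\ real_rooted q,
      forall x, (root p x -> mup x p = 1%N) /\ (root q x -> mup x q = 1%N),
      forall x, ~~ (root p x && root q x)
    & zeros_separated p q /\ zeros_separated q p].

End Polynomials.

Section TypeII.
Context {R : realType} {s : nat}.
Implicit Types (n : 'I_s -> nat) (P : {poly R}).

Definition mi_norm n := (\sum_j n j)%N.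

Definition mi_succ n j : 'I_s -> nat := fun i => (n i + (i == j))%N.

(* A possibly signed measure enters the definition of multiple orthogonality
   only through its integral, so systems of s signed measures are represented
   by the s functionals f |-> \int f. *)
Implicit Type L : 'I_s -> (R -> R) -> R.

Definition typeII_cond L n P :=
  (size P <= (mi_norm n).+1)%N /\
  forall j p, (p < n j)%N -> L j (fun x => P.[x] * x ^+ p) = 0.

Definition normal_index L n :=
  forall P, P != 0 -> typeII_cond L n P -> size P = (mi_norm n).+1.

(* For a normal index this is the unique monic solution. *)
Definition typeII_poly L n : {poly R} :=
  xget 0 [set P | P \is monic /\ typeII_cond L n P].

Definition perfect (I : set ('I_s -> nat)) L :=
  forall n, I n -> normal_index L n.

End TypeII.

Section Systems.
Context {R : realType} {s : nat}.
Local Notation meas := {measure set (measurableTypeR R) -> \bar R}.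
Implicit Type mu : 'I_s -> meas.

Definition msupp (m : meas) : set R :=
  [set x | forall U : set R, open U -> U x -> (0 < m U)%E].

Definition finite_moments (m : meas) :=
  forall n, m.-integrable [set: R] (fun x : R => (x ^+ n)%:E).

(* (mu_1, ..., mu_s) *)
Definition system mu (j : 'I_s) (f : R -> R) : R :=
  \int[mu j]_x f x.

(* ((x - z0) mu_1, ..., (x - z0) mu_s) *)
Definition christoffel mu (z0 : R) (j : 'I_s) (f : R -> R) : R :=
  \int[mu j]_x (f x * ((x : R) - z0)).

Definition hull (A : set R) : set R := [set` Rhull A].

(* The interior of a nonempty interval D, relative to its affine hull: it is the
   topological interior unless D is a single point, in which case it is D. *)
Definition relint (D : set R) : set R := D° `|` [set x | D = [set x]].

(* Taking the topological interior for the hull of a one-point support would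
   allow a point mass strictly inside another hull, and then indices in N^s_K
   need not be normal, e.g. (1, 1) for Lebesgue measure on [-1, 1] and the Dirac
   measure at 0. *)
Definition angelesco mu :=
  forall k j, k != j ->
    relint (hull (msupp (mu k))) `&` relint (hull (msupp (mu j))) = set0 /\
    (finite_set (msupp (mu k)) -> finite_set (msupp (mu j)) ->
     hull (msupp (mu k)) `&` hull (msupp (mu j)) = set0).

Definition chebyshev_system (I : set R) (T : finType) (f : T -> R -> R) :=
  forall c : T -> R, (exists t, c t != 0) ->
    [set x | I x /\ \sum_t c t * f t x = 0] #<= `I_(#|T|.-1).

Definition AT_system mu :=
  exists (I : set R) (m : meas) (w : 'I_s -> R -> R),
    [/\ is_interval I, m (~` I) = 0%E,
        forall j, {within I, continuous (w j)},
        forall j (A : set R), measurable (A : set (measurableTypeR R)) ->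
          mu j A = (\int[m]_(x in A `&` I) (w j x)%:E)%E
      & forall n : 'I_s -> nat, (exists j, n j != 0%N) ->
          chebyshev_system I
            (fun (t : {j : 'I_s & 'I_(n j)}) (x : R) =>
               x ^+ tagged t * w (tag t) x)].

(* N^s_K, where K_j = N_j is the (possibly infinite) number of points of
   supp mu_j. *)
Definition box mu : set ('I_s -> nat) :=
  [set n | forall j, `I_(n j) #<= msupp (mu j)].

(* If the supports have together fewer than |n| points, then a nonzero
   polynomial of degree less than |n| vanishes on all of them and n is not
   normal. This happens in N^s_K only for AT systems with s >= 2 and finite
   supports (which all coincide). For the other systems [indices mu] is N^s_K:
   see [angelesco_indices] and [infinite_indices] below. *)
Definition indices mu : set ('I_s -> nat) :=
  box mu `&` [set n | `I_(mi_norm n) #<= \bigcup_j msupp (mu j)].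

(* n_i = N_i. In that case P_n vanishes on the whole of supp mu_i. *)
Definition saturated mu (n : 'I_s -> nat) (i : 'I_s) : bool :=
  msupp (mu i) #= `I_(n i).

Lemma infinite_indices mu i :
  infinite_set (msupp (mu i)) -> indices mu = box mu.
Proof.
move=> /infiniteP si; apply/seteqP; split=> [n []//|n nb]; split=> //=.
apply: card_le_trans (subset_card_le (bigcup_sup (i := i) I)).
by apply: card_le_trans si; exact: subset_card_le.
Qed.

Lemma disjoint_indices mu :
  (forall i j, i != j -> msupp (mu i) `&` msupp (mu j) = set0) ->
  indices mu = box mu.
Proof.
move=> dis; apply/seteqP; split=> [n []//|n nb]; split=> //=.
have /all_sig2[f fS fI] j : {f : 'I_(n j) -> R |
    forall x, msupp (mu j) (f x) & injective f}.
  apply: cid2; have := nb j; rewrite (card_le_eql card_II) => /pcard_leP[g].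
  exists g => [x|x y]; first exact: (@funS _ _ _ _ g x).
  by apply: 'inj_g; rewrite inE.
pose g (t : {j : 'I_s & 'I_(n j)}) : R := f (tag t) (tagged t).
have cT : mi_norm n = #|{: {j : 'I_s & 'I_(n j)}}|.
  rewrite card_tagged sumnE big_map big_enum /=.
  by apply: eq_bigr => j _; rewrite card_ord.
pose h (x : 'I_(mi_norm n)) := g (enum_val (cast_ord cT x)).
have gI : injective g.
  move=> [i x] [j y]; rewrite /g /= => e.
  have [ij|ij] := eqVneq i j; first by subst j; rewrite (fI _ _ _ e).
  have : (msupp (mu i) `&` msupp (mu j)) (f i x).
    by split; [exact: fS | rewrite e; exact: fS].
  by rewrite dis.
have hI : {in [set: 'I_(mi_norm n)] &, injective h}.
  by move=> x y _ _ /gI /enum_val_inj /cast_ord_inj.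
rewrite (card_le_eql card_II) -(card_le_eql (inj_card_eq hI)).
apply: subset_card_le => _ [x _ <-].
by exists (tag (enum_val (cast_ord cT x))) => //; exact: fS.
Qed.

Lemma angelesco_indices mu : angelesco mu -> indices mu = box mu.
Proof.
move=> ang; have [[i si]|fin] := pselect (exists i, infinite_set (msupp (mu i))).
  exact: infinite_indices si.
apply: disjoint_indices => i j ij; rewrite -subset0.
have fins k : finite_set (msupp (mu k)).
  by apply: contrapT => ?; apply: fin; exists k.
have [_ /(_ (fins i) (fins j)) <-] := ang _ _ ij.
by move=> x [xi xj]; split; exact: sub_Rhull.
Qed.

End Systems.

(* Main.v *)
(**
  Both systems share one property: a nonzero polynomial T orthogonal with
  respect to k has at least |k| distinct real zeros, and if k is unsaturated
  and k + e_j is an index, then at least |k| zeros of odd order, unless it has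
  |k| + 1 distinct ones. If T had too few sign changes, multiply it by a
  combination of the functions x^p w_j with the same sign pattern: the product
  integrates to 0 and has a sign, so T vanishes on the support. For Angelesco
  systems this combination is a polynomial for each measure separately; for AT
  systems it is a determinant, whose sign pattern follows from the
  connectedness of the set of increasing tuples.

  Hence T = (x - z0) Q, with Q orthogonal for the Christoffel transform,
  cannot have degree at most |k|: it would be a multiple of P_k and P_k(z0) =
  0. All members of the space of k-orthogonal polynomials of degree at most
  |k| + 1 have only simple real zeros; this space contains (x - z0) Q, P_k and
  P_(k + e_j). If all the nonzero combinations of p and q have simple zeros,
  then the Wronskian of p and q has no zero, and so p and q interlace.
*)
Require Import Defs.
From HB Require Import structures.
From mathcomp Require Import all_boot all_order all_algebra.
From mathcomp Require Import all_classical all_reals all_analysis.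
From mathcomp Require Import measurable_realfun complex ring lra zify.

Import Order.TTheory GRing.Theory Num.Theory.
Import numFieldNormedType.Exports.

Local Open Scope classical_set_scope.
Local Open Scope ring_scope.

(** * Real polynomials: zeros of odd order, simple zeros, interlacing through the Wronskian *)

Section RealPolynomials.
Context {R : realType}.
Implicit Types (p q T : {poly R}) (rs : seq R).

Lemma poly_ivt_lt p a b : a < b -> p.[a] * p.[b] < 0 ->
  exists2 x, a < x < b & root p x.
Proof.
move=> ab pab.
have main q : q.[a] < 0 -> 0 < q.[b] -> exists2 x, a < x < b & root q x.
  move=> qa qb.
  have [|x /andP[ax xb] rx] := @poly_ivt R q a b (ltW ab).
    by rewrite (ltW qa) (ltW qb).
  exists x => //; rewrite !lt_neqAle ax xb !andbT.
  apply/andP; split; apply/eqP => e; move: rx qa qb; rewrite -?e rootE ?e.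
    by move=> /eqP ->; rewrite ltxx.
  by move=> /eqP -> _; rewrite ltxx.
have [pa|pa|pa] := ltgtP p.[a] 0.
- by apply: main => //; move: pab; rewrite nmulr_rlt0.
- have [x xab rx] : exists2 x, a < x < b & root (- p) x.
    apply: main; rewrite hornerN ?oppr_lt0 ?oppr_gt0 //.
    by move: pab; rewrite pmulr_rlt0.
  by exists x => //; rewrite -rootN.
- by move: pab; rewrite pa mul0r ltxx.
Qed.

(** Induction on the size: if the root given by the intermediate value theorem has even order,
    dividing by its full power, which is nonnegative everywhere, preserves the opposite signs at [a]
    and [b]. *)
Lemma odd_root_between p a b : a < b -> p.[a] * p.[b] < 0 ->
  exists2 x, a < x < b & odd (mup x p).
Proof.
have [n] := ubnP (size p); elim: n p => // n IH p.
move=> sp ab pab; have [x xab rx] := poly_ivt_lt _ _ _ ab pab.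
have p0 : p != 0 by apply: contraTneq pab => ->; rewrite !horner0 mul0r ltxx.
case o : (odd (mup x p)); first by exists x.
have [q qd] : exists q, p = q * ('X - x%:P) ^+ mup x p.
  by apply/dvdpP; rewrite -mup_geq.
have m1 : (0 < mup x p)%N by rewrite -XsubC_dvd // dvdp_XsubCl.
have q0 : q != 0 by apply: contraNneq p0 => q0; rewrite qd q0 mul0r.
have e y : p.[y] = q.[y] * (y - x) ^+ mup x p by rewrite {1}qd !hornerE.
have pos y : 0 <= (y - x) ^+ mup x p by rewrite exprn_even_ge0 // o.
have qab : q.[a] * q.[b] < 0.
  rewrite ltNge; apply: contraTN pab => qab; rewrite -leNgt !e.
  by rewrite mulrACA mulr_ge0 // mulr_ge0.
have X0 : ('X - x%:P) ^+ mup x p != 0 by rewrite expf_neq0 // polyXsubC_eq0.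
have sq : (size q < n)%N.
  rewrite -ltnS; apply: leq_trans sp; rewrite ltnS [in X in (_ < size X)%N]qd.
  rewrite size_mul // size_exp_XsubC; move: m1; case: (mup x p) => // k _.
  by rewrite addnS /= addnS ltnS leq_addr.
have [y yab oy] := IH q sq ab qab; exists y => //.
have nr : ~~ root q x.
  apply: contraFN (ltnn (mup x p)) => rq.
  have /dvdpP[q' qd'] : 'X - x%:P %| q by rewrite dvdp_XsubCl.
  by rewrite mup_geq // [X in _ %| X]qd qd' -mulrA -exprS dvdp_mull.
have xy : x != y.
  by apply: contraTneq oy => <-; rewrite (mupNroot nr).
by rewrite qd mupM // mup_XsubCX (negPf xy) addn0.
Qed.

(** The explicit factorization makes real-rootedness, simplicity and [p != 0] available together. *)
Definition real_simple p :=
  exists c rs, [/\ c != 0, uniq rs & p = c *: \prod_(z <- rs) ('X - z%:P)].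

(** The cofactor of the known roots has degree at most one, so it splits over [R] as well. The extra
    root [r] may repeat a member of [rs]. *)
Lemma near_split p rs : p != 0 -> uniq rs -> all (root p) rs ->
  (size p <= (size rs).+2)%N ->
  exists c ts, [/\ c != 0, p = c *: \prod_(z <- ts) ('X - z%:P) &
                   ts = rs \/ exists r, ts = r :: rs].
Proof.
move=> p0 u rp sp.
have /dvdpP[q pd] : \prod_(z <- rs) ('X - z%:P) %| p.
  by rewrite uniq_roots_dvdp // uniq_rootsE.
have q0 : q != 0 by apply: contraNneq p0 => q0; rewrite pd q0 mul0r.
have sq : (size q <= 2)%N.
  move: sp; rewrite pd size_mul // ?monic_neq0 ?monic_prod_XsubC //.
  rewrite size_prod_XsubC addnS /=; rewrite -[(size rs).+2]add2n.
  by rewrite leq_add2r.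
have [s1|s1] := leqP (size q) 1.
  exists q`_0, rs; split; last by left.
    by apply: contraNneq q0 => c0; rewrite (size1_polyC s1) c0.
  by rewrite {1}pd {1}(size1_polyC s1) mul_polyC.
have s2 : size q = 2 by apply/eqP; rewrite eqn_leq sq.
have q1 : q`_1 != 0 by move: q0; rewrite -lead_coef_eq0 lead_coefE s2.
exists q`_1, (- q`_0 / q`_1 :: rs); split => //; last by right; eexists.
rewrite big_cons {1}pd scalerAl; congr (_ * _).
apply/polyP => i; rewrite coefZ coefB coefX coefC.
case: i => [|[|i]] /=.
- by rewrite sub0r mulNr opprK mulrC divfK.
- by rewrite subr0 mulr1.
- by rewrite subr0 mulr0 nth_default // s2.
Qed.

Lemma split_real_rooted c (ts : seq R) : c != 0 ->
  real_rooted (c *: \prod_(z <- ts) ('X - z%:P)).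
Proof.
move=> c0 z; rewrite map_polyZ /= rootZ ?fmorph_eq0 //.
rewrite rmorph_prod /=; elim: ts => [|t ts IH];
    first by rewrite big_nil rootE hornerC oner_eq0.
rewrite big_cons rootM => /orP[|/IH //].
by rewrite map_polyXsubC root_XsubC => /eqP ->.
Qed.

Lemma real_rooted_near_split p rs : p != 0 -> uniq rs -> all (root p) rs ->
  (size p <= (size rs).+2)%N -> real_rooted p.
Proof.
move=> p0 u rp sp; have [c [ts [c0 -> _]]] := near_split _ _ p0 u rp sp.
exact: split_real_rooted.
Qed.

Lemma real_simple_distinct p rs : p != 0 -> uniq rs -> all (root p) rs ->
  (size p <= (size rs).+1)%N -> real_simple p.
Proof.
move=> p0 u rp sp.
have [|c [ts [c0 pd [tsd|[r tsd]]]]] := near_split _ _ p0 u rp.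
- exact: leq_trans sp _.
- by exists c, ts; split => //; rewrite tsd.
- by move: sp; rewrite pd size_scale // size_prod_XsubC tsd /= ltnn.
Qed.

Lemma mup_split c (ts : seq R) x : c != 0 ->
  mup x (c *: \prod_(z <- ts) ('X - z%:P)) = count_mem x ts.
Proof.
move=> c0; rewrite -mul_polyC mupMr ?mu_prod_XsubC //.
by rewrite rootC.
Qed.

(** The degree may exceed the number of known roots by one; if the extra root repeated one of them,
    that root would have the even order 2. *)
Lemma real_simple_odd p rs : p != 0 -> uniq rs ->
  all (fun x => odd (mup x p)) rs ->
  (size p <= (size rs).+2)%N -> real_simple p.
Proof.
move=> p0 u op sp.
have rp : all (root p) rs.
  apply/allP => x /(allP op); apply: contraTT => nr.
  by rewrite mupNroot.
have [c [ts [c0 pd tsd]]] := near_split _ _ p0 u rp sp.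
exists c, ts; split => //; case: tsd => [->//|[r tsd]].
rewrite tsd /= u andbT; apply/negP => rrs.
move: (allP op _ rrs); rewrite pd mup_split // tsd /= eqxx.
by rewrite count_uniq_mem // rrs.
Qed.

Lemma real_simple_rooted p : real_simple p -> real_rooted p.
Proof. by move=> [c [ts [c0 _ ->]]]; exact: split_real_rooted. Qed.

Lemma real_simple_mup p x : real_simple p -> root p x -> mup x p = 1%N.
Proof.
move=> [c [ts [c0 u ->]]]; rewrite rootZ // root_prod_XsubC => xts.
by rewrite mup_split // count_uniq_mem // xts.
Qed.

Lemma real_simple_neq0 p : real_simple p -> p != 0.
Proof.
move=> [c [ts [c0 u ->]]]; rewrite scaler_eq0 negb_or c0.
by rewrite monic_neq0 // monic_prod_XsubC.
Qed.

Lemma real_simple_deriv p x : real_simple p -> root p x -> p^`().[x] != 0.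
Proof.
move=> ps rx; have p0 := real_simple_neq0 _ ps.
apply/eqP => d0; have := real_simple_mup _ _ ps rx.
have /factor_theorem[q pd] := rx.
have /factor_theorem[r qd] : root q x.
  rewrite rootE; move: d0; rewrite pd derivM derivXsubC !hornerE.
  by rewrite subrr mulr0 add0r => ->.
have : (2 <= mup x p)%N.
  by rewrite mup_geq // pd qd -mulrA -expr2 dvdp_mull.
by move=> + e; rewrite e.
Qed.

(** The first root to the right of [a] exists because roots are finitely many: while a root lies
    strictly before [b], divide out ['X - b%:P] and continue with that root. *)
Lemma next_root_between q a b : q != 0 -> a < b -> root q b ->
  exists c, [/\ a < c <= b, root q c & forall x, a < x < c -> ~~ root q x].
Proof.
have [n] := ubnP (size q); elim: n q b => // n IH q b sq q0 ab rb.
have [[c /andP[ac cb] rc]|nr] := pselect (exists2 c, a < c < b & root q c);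
    last first.
  exists b; split; rewrite ?ab ?lexx // => x xab.
  by apply/negP => rx; apply: nr; exists x.
have /factor_theorem[q' qd] := rb.
have q'0 : q' != 0 by apply: contraNneq q0 => h; rewrite qd h mul0r.
have rq x : x != b -> root q x = root q' x.
  by move=> xb; rewrite qd rootM root_XsubC (negPf xb) orbF.
have sq' : (size q' < n)%N.
  by move: sq; rewrite qd size_mul ?polyXsubC_eq0 // size_XsubC addn2.
have [|d [/andP[ad dc] rd nd]] := IH q' c sq' q'0 ac.
  by rewrite -rq // lt_eqF.
have db : d < b by apply: le_lt_trans cb.
exists d; split; rewrite ?ad ?(ltW db) ?rq ?lt_eqF // => x /andP[ax xd].
by rewrite rq ?nd ?ax ?xd // lt_eqF // (lt_trans xd).
Qed.

Lemma same_sign_noroot p a b : a < b -> p.[a] != 0 -> p.[b] != 0 ->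
  (forall c, a < c < b -> ~~ root p c) -> 0 < p.[a] * p.[b].
Proof.
move=> ab pa pb nr; rewrite lt_neqAle eq_sym mulf_neq0 //= leNgt.
by apply/negP => /(poly_ivt_lt _ _ _ ab)[c /nr/negP].
Qed.

Definition wronskian p q := p * q^`() - p^`() * q.

Lemma wronskianN p q : wronskian q p = - wronskian p q.
Proof. by rewrite /wronskian; ring. Qed.

(** At a zero of [p] the Wronskian is [- p' q]. It keeps its sign, while [p'] has opposite signs at
    consecutive zeros of [p], so [q] changes sign between them. *)
Lemma root_between_wronskian p q a b :
  (forall x, ~~ root (wronskian p q) x) ->
  a < b -> root p a -> root p b -> (forall c, a < c < b -> ~~ root p c) ->
  exists2 c, a < c < b & root q c.
Proof.
move=> W0 ab ra rb nr; apply: poly_ivt_lt => //.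
have /factor_theorem[p1 p1d] := ra.
have /factor_theorem[r rd] : root p1 b.
  by move: rb; rewrite p1d rootM root_XsubC gt_eqF // orbF.
have pd : p = r * ('X - b%:P) * ('X - a%:P) by rewrite p1d rd.
have da : p^`().[a] = r.[a] * (a - b).
  by rewrite pd !derivM !derivXsubC !hornerE; ring.
have db : p^`().[b] = r.[b] * (b - a).
  by rewrite pd !derivM !derivXsubC !hornerE; ring.
have Wa : (wronskian p q).[a] = - (p^`().[a] * q.[a]).
  by rewrite /wronskian !hornerE (rootP ra) mul0r sub0r.
have Wb : (wronskian p q).[b] = - (p^`().[b] * q.[b]).
  by rewrite /wronskian !hornerE (rootP rb) mul0r sub0r.
have Wab : 0 < (wronskian p q).[a] * (wronskian p q).[b].
  by apply: same_sign_noroot => //; exact: W0.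
(* With [p = r (x - a) (x - b)], the product [p'(a) p'(b)] is [- r(a) r(b) (b - a)^2], and [r] has
   no zero on the closed interval. *)
have rab : 0 < r.[a] * r.[b].
  apply: same_sign_noroot => // [||c cab].
  - by apply: contraNneq (W0 a) => h; rewrite rootE Wa da h !mul0r oppr0.
  - by apply: contraNneq (W0 b) => h; rewrite rootE Wb db h !mul0r oppr0.
  - by apply: contraNN (nr c cab) => rc; rewrite pd !rootM rc.
have e : (wronskian p q).[a] * (wronskian p q).[b] =
    - ((r.[a] * r.[b] * (b - a) ^+ 2) * (q.[a] * q.[b])).
  by rewrite Wa Wb da db; ring.
move: Wab; rewrite e oppr_gt0 pmulr_rlt0 // mulr_gt0 // exprn_even_gt0 //=.
by rewrite subr_eq0 gt_eqF.
Qed.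

(** Existence is the previous lemma. For uniqueness, exchange the roles: two zeros of [q] in the gap
    would enclose a zero of [p]. *)
Lemma zeros_separated_wronskian p q :
  q != 0 -> (forall x, ~~ root (wronskian p q) x) -> zeros_separated p q.
Proof.
move=> q0 W0 a b ab ra rb nr.
have [c cab rc] := root_between_wronskian _ _ _ _ W0 ab ra rb nr.
have W0' x : ~~ root (wronskian q p) x by rewrite wronskianN rootN.
have lone c1 c2 : a < c1 < b -> a < c2 < b -> root q c1 -> root q c2 ->
    ~~ (c1 < c2).
  move=> /andP[ac1 c1b] /andP[ac2 c2b] rc1 rc2; apply/negP => c12.
  have [d [/andP[cd dc] rd nd]] := next_root_between _ _ _ q0 c12 rc2.
  have [e /andP[ce ed]] := root_between_wronskian _ _ _ _ W0' cd rc1 rd nd.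
  apply/negP/nr; rewrite (lt_trans ac1 ce) (lt_trans ed) //.
  exact: le_lt_trans c2b.
exists c; split; first by rewrite cab rc.
move=> d /andP[dab rd].
by apply/eqP; rewrite eq_le !leNgt !lone.
Qed.

(** At a common zero or a zero of the Wronskian, some nontrivial combination of [p] and [q] would
    have a double zero. *)
Lemma interlace_pencil p q :
  (forall a b, (a != 0) || (b != 0) -> real_simple (a *: p + b *: q)) ->
  interlace p q.
Proof.
move=> H.
have ps : real_simple p by have := H 1 0;
    rewrite scale1r scale0r addr0 oner_neq0; apply.
have qs : real_simple q by have := H 0 1;
    rewrite scale1r scale0r add0r oner_neq0 orbT; apply.
have dbl a b x : (a != 0) || (b != 0) -> a * p.[x] + b * q.[x] = 0 ->
    a * p^`().[x] + b * q^`().[x] != 0.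
  move=> /H s e; have := real_simple_deriv _ x s.
  by rewrite rootE derivD !derivZ !hornerE e eqxx; apply.
have com x : ~~ (root p x && root q x).
  apply/negP => /andP[rp rq].
  (* At a common zero every combination vanishes; these coefficients make its derivative vanish
     too. *)
  have := dbl q^`().[x] (- p^`().[x]) x.
  rewrite (rootP rp) (rootP rq) !mulr0 addr0 (real_simple_deriv _ _ qs rq).
  by move=> /(_ isT erefl) /negP; apply; apply/eqP; ring.
have W0 x : ~~ root (wronskian p q) x.
  apply/negP; rewrite rootE /wronskian !hornerE => /eqP w.
  (* The combination [q(x) p - p(x) q] vanishes at [x], and its derivative there is minus the
     Wronskian. *)
  have := dbl q.[x] (- p.[x]) x.
  have -> : (q.[x] != 0) || (- p.[x] != 0).
    by move: (com x); rewrite negb_and oppr_eq0 !rootE orbC.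
  move=> /(_ isT) h; have /negP := h ltac:(ring); apply; apply/eqP.
  by rewrite -[RHS]oppr0 -w; ring.
have W0' x : ~~ root (wronskian q p) x by rewrite wronskianN rootN.
split=> //.
- by split; exact: real_simple_rooted.
- by move=> x; split; exact: real_simple_mup.
- by split; apply: zeros_separated_wronskian => //; exact: real_simple_neq0.
Qed.

End RealPolynomials.

(** * Linear algebra of type II polynomials and the Christoffel transform *)

Section TypeIIPolynomials.
Context {R : realType} {s : nat}.
Implicit Types (L : 'I_s -> (R -> R) -> R) (n k : 'I_s -> nat) (P Q T : {poly R}).

(** Linearity is asked on polynomials only, since the integral is linear only on integrable
    functions. *)
Definition poly_linear L := forall j a P T,
  L j (horner (a *: P + T)) = a * L j (horner P) + L j (horner T).

(** The degree bound of [typeII_cond] is dropped, so that [('X - z0%:P) * Q] and the polynomial of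
    [mi_succ n j] also qualify. *)
Definition orthogonal L n P :=
  forall j p, (p < n j)%N -> L j (fun x => P.[x] * x ^+ p) = 0.

Definition many_zeros L n := forall T, T != 0 -> orthogonal L n T ->
  exists rs, [/\ uniq rs, all (root T) rs & (mi_norm n <= size rs)%N].

(** Either alternative forces simple real zeros when the degree is at most [mi_norm n + 1]. The
    second one serves the case where [T] vanishes on a whole support: the parity of those zeros is
    unknown, but there is one more of them. *)
Definition many_odd_zeros L n := forall T, T != 0 -> orthogonal L n T ->
  exists2 rs, uniq rs &
    all (fun x => odd (mup x T)) rs /\ (mi_norm n <= size rs)%N \/
    all (root T) rs /\ (mi_norm n < size rs)%N.

Lemma poly_linear0 L j : poly_linear L -> L j (horner 0) = 0.
Proof.
move=> lin; have := lin j 1 0 0; rewrite scaler0 addr0 mul1r => /eqP.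
by rewrite -subr_eq0 opprD addNKr oppr_eq0 => /eqP.
Qed.

Lemma poly_linear_sum L j (I : Type) (r : seq I) (c : I -> R)
    (f : I -> {poly R}) : poly_linear L ->
  L j (horner (\sum_(i <- r) c i *: f i)) =
  \sum_(i <- r) c i * L j (horner (f i)).
Proof.
move=> lin; elim: r => [|i r IH]; first by rewrite !big_nil poly_linear0.
by rewrite !big_cons lin IH.
Qed.

Lemma hornerMXn P p : (fun x => P.[x] * x ^+ p) = horner (P * 'X^p).
Proof. by apply/funext => x; rewrite !hornerE. Qed.

Lemma orthogonal_comb L n a b P T : poly_linear L ->
  orthogonal L n P -> orthogonal L n T -> orthogonal L n (a *: P + b *: T).
Proof.
move=> lin oP oT j p pn; rewrite hornerMXn mulrDl -!scalerAl lin -hornerMXn.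
rewrite oP // mulr0 add0r -[X in horner X]addr0 lin poly_linear0 //.
by rewrite -hornerMXn oT // mulr0 addr0.
Qed.

Lemma orthogonal_poly L n P Q j : poly_linear L -> orthogonal L n P ->
  (size Q <= n j)%N -> L j (horner (P * Q)) = 0.
Proof.
move=> lin oP sq; have -> : P * Q = \sum_(i < size Q) Q`_i *: (P * 'X^i).
  rewrite -[in LHS](coefK Q) poly_def mulr_sumr.
  by apply: eq_bigr => i _; rewrite scalerAr.
rewrite poly_linear_sum // big1 // => i _.
by rewrite -hornerMXn oP ?mulr0 // (leq_trans (ltn_ord i)).
Qed.

Lemma orthogonal_le L n k P : (forall j, n j <= k j)%N ->
  orthogonal L k P -> orthogonal L n P.
Proof. by move=> nk oP j p pn; apply: oP; apply: leq_trans (nk j). Qed.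

Lemma card_mi n : #|{: {j : 'I_s & 'I_(n j)}}| = mi_norm n.
Proof.
rewrite card_tagged sumnE big_map big_enum.
by apply: eq_bigr => j _; exact: card_ord.
Qed.

Lemma mi_norm_succ n (j : 'I_s) : mi_norm (mi_succ n j) = (mi_norm n).+1.
Proof.
rewrite /mi_norm /mi_succ big_split /= -addn1; congr addn.
by rewrite (bigD1 j) //= eqxx big1 // => i /negPf ->.
Qed.

(** The conditions are [mi_norm n] homogeneous linear equations in [mi_norm n + 1] coefficients; a
    solution is a vector of the left kernel of the moment matrix [A]. *)
Lemma typeII_nonzero_solution L n : poly_linear L ->
  exists2 P, P != 0 & typeII_cond L n P.
Proof.
move=> lin; pose N := #|{: {j : 'I_s & 'I_(n j)}}|.
pose A := \matrix_(i < N.+1, t < N)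
  L (tag (enum_val t)) (horner ('X^i * 'X^(tagged (enum_val t)))).
have K0 : kermx A != 0.
  rewrite -mxrank_eq0 mxrank_ker -lt0n subn_gt0 ltnS.
  exact: rank_leq_col.
pose v := nz_row (kermx A).
have v0 : v != 0 by rewrite nz_row_eq0.
have vA : v *m A = 0.
  by apply/sub_kermxP; exact: nz_row_sub.
pose P := \sum_(i < N.+1) v 0 i *: 'X^i.
have Pd : P = \poly_(i < N.+1) (v 0 (inord i)).
  by rewrite /P poly_def; under [RHS]eq_bigr do rewrite inord_val.
exists P.
  have [i vi] : exists i, v 0 i != 0.
    apply/existsP; apply: contraNT v0; rewrite negb_exists => /forallP h.
    by apply/eqP/rowP => i; rewrite mxE; apply/eqP; have := h i; rewrite negbK.
  apply: contraNneq vi => P0; have : P`_i = 0 by rewrite P0 coef0.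
  by rewrite Pd coef_poly ltn_ord inord_val => ->.
split; first by rewrite Pd -card_mi; exact: size_poly.
move=> j p pn; rewrite hornerMXn mulr_suml.
under eq_bigr do rewrite -scalerAl.
rewrite poly_linear_sum //.
have /matrixP /(_ 0 (enum_rank (Tagged _ (Ordinal pn)))) := vA.
rewrite mxE [RHS]mxE => {2}<-; apply: eq_bigr => i _.
by rewrite mxE enum_rankK.
Qed.

Lemma typeII_polyP L n : poly_linear L -> normal_index L n ->
  typeII_poly L n \is monic /\ typeII_cond L n (typeII_poly L n).
Proof.
move=> lin nn; have [P P0 [sP oP]] := typeII_nonzero_solution _ n lin.
apply: (@xgetPex _ 0 [set Q | Q \is monic /\ typeII_cond L n Q]).
exists ((lead_coef P)^-1 *: P).
have c0 : (lead_coef P)^-1 != 0 by rewrite invr_eq0 lead_coef_eq0.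
split; first by rewrite monicE lead_coefZ mulVf // lead_coef_eq0.
split; first by rewrite size_scale.
have := orthogonal_comb L n (lead_coef P)^-1 0 P P lin oP oP.
by rewrite scale0r addr0.
Qed.

Lemma typeII_poly_size L n : poly_linear L -> normal_index L n ->
  size (typeII_poly L n) = (mi_norm n).+1.
Proof.
move=> lin nn; have [m c] := typeII_polyP _ _ lin nn.
by apply: nn => //; exact: monic_neq0.
Qed.

(** The leading terms cancel in the difference, whose degree is then below [mi_norm n]; normality
    forces it to be 0. *)
Lemma typeII_poly_unique L n T : poly_linear L -> normal_index L n ->
  typeII_cond L n T -> T = lead_coef T *: typeII_poly L n.
Proof.
move=> lin nn [sT oT]; have [Pm [sP oP]] := typeII_polyP _ _ lin nn.
have [->|T0] := eqVneq T 0; first by rewrite lead_coef0 scale0r.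
have sT' := nn _ T0 (conj sT oT).
apply/eqP; rewrite -subr_eq0; apply/eqP/eqP/negPn/negP => D0.
have cD : typeII_cond L n (T - lead_coef T *: typeII_poly L n).
  split; last first.
    by rewrite -[T in T - _]scale1r -scaleNr; exact: orthogonal_comb.
  rewrite (leq_trans (size_polyD _ _)) // geq_max sT size_polyN.
  by rewrite (leq_trans (size_scale_leq _ _)).
have := nn _ D0 cD; apply/eqP; rewrite neq_ltn; apply/orP; left.
rewrite ltnS; apply/leq_sizeP => i; rewrite leq_eqVlt => /orP[/eqP <-|ni].
  rewrite coefB coefZ lead_coefE sT' /= -[X in _ * _`_X]/(mi_norm n).+1.-1.
  rewrite -[in X in _ * _`_X](typeII_poly_size _ _ lin nn) -lead_coefE.
  by rewrite (eqP Pm) mulr1 subrr.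
rewrite coefB coefZ !nth_default ?mulr0 ?subrr //.
  exact: leq_trans ni.
by rewrite sT'.
Qed.

Lemma normal_many_zeros L n : many_zeros L n -> normal_index L n.
Proof.
move=> mz P P0 [sP oP]; apply/eqP; rewrite eqn_leq sP /=.
have [rs [u rr nrs]] := mz _ P0 oP.
exact: leq_ltn_trans nrs (max_poly_roots P0 rr u).
Qed.

(** Every nonzero combination is again orthogonal of degree at most [mi_norm n + 1], hence has only
    simple real zeros. *)
Lemma interlace_orthogonal L n P T : poly_linear L -> many_odd_zeros L n ->
  orthogonal L n P -> orthogonal L n T ->
  (size P <= (mi_norm n).+2)%N -> (size T <= (mi_norm n).+2)%N ->
  (forall a b, (a != 0) || (b != 0) -> a *: P + b *: T != 0) ->
  interlace P T.
Proof.
move=> lin mz oP oT sP sT ind; apply: interlace_pencil => a b ab.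
have F0 := ind a b ab; set F := _ + _ in F0 *.
have oF : orthogonal L n F by exact: orthogonal_comb.
have sF : (size F <= (mi_norm n).+2)%N.
  rewrite (leq_trans (size_polyD _ _)) // geq_max.
  by rewrite !(leq_trans (size_scale_leq _ _)).
have [rs u] := mz _ F0 oF; move=> [] [rr nrs].
  by apply: (real_simple_odd _ rs) => //; rewrite (leq_trans sF) // !ltnS.
by apply: (real_simple_distinct _ rs) => //; rewrite (leq_trans sF) // !ltnS.
Qed.

Section Christoffel.
Variables (L L' : 'I_s -> (R -> R) -> R) (z0 : R).
Hypothesis lin : poly_linear L.
Hypothesis LL' : forall j P,
  L' j (horner P) = L j (horner (('X - z0%:P) * P)).

Lemma christoffel_linear : poly_linear L'.
Proof. by move=> j a P T; rewrite !LL' mulrDr -scalerAr lin. Qed.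

Lemma christoffel_orthogonal n P :
  orthogonal L' n P -> orthogonal L n (('X - z0%:P) * P).
Proof.
by move=> oP j p pn; rewrite hornerMXn -mulrA -LL' -hornerMXn oP.
Qed.

Lemma size_XsubC_mul P : P != 0 -> size (('X - z0%:P) * P) = (size P).+1.
Proof. by move=> P0; rewrite size_mul ?polyXsubC_eq0 // size_XsubC. Qed.

Lemma christoffel_normal n : normal_index L n -> ~~ root (typeII_poly L n) z0 ->
  normal_index L' n.
Proof.
move=> nn rP Q Q0 [sQ oQ]; apply/eqP; rewrite eqn_leq sQ /= ltnNge.
apply/negP => sQ'; pose T := ('X - z0%:P) * Q.
have T0 : T != 0 by rewrite mulf_neq0 ?polyXsubC_eq0.
have cT : typeII_cond L n T.
  by split; [rewrite size_XsubC_mul | exact: christoffel_orthogonal].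
(* At [z0] the left side vanishes, and neither factor on the right does. *)
have /(congr1 (horner^~ z0)) := typeII_poly_unique _ _ _ lin nn cT.
rewrite hornerZ hornerM hornerXsubC subrr mul0r => /esym/eqP.
by rewrite mulf_eq0 lead_coef_eq0 (negPf T0) /= -rootE (negPf rP).
Qed.

(** The product [('X - z0%:P) * Q] has degree at most [mi_norm n + 1] and at least [mi_norm n]
    distinct real zeros, so what remains is at most linear. Parity is not involved, so saturated
    indices are covered. *)
Lemma christoffel_real_rooted n : many_zeros L n -> normal_index L' n ->
  real_rooted (typeII_poly L' n).
Proof.
move=> mz nn'; have [Qm [sQ oQ]] := typeII_polyP _ _ christoffel_linear nn'.
set Q := typeII_poly L' n in Qm sQ oQ *.
have Q0 := monic_neq0 Qm.
have T0 : ('X - z0%:P) * Q != 0 by rewrite mulf_neq0 ?polyXsubC_eq0.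
have [rs [u rr nrs]] := mz _ T0 (christoffel_orthogonal _ _ oQ).
have TR : real_rooted (('X - z0%:P) * Q).
  apply: (real_rooted_near_split _ rs) => //.
  by rewrite size_XsubC_mul // ltnS (leq_trans sQ).
by move=> z rz; apply: TR; rewrite rmorphM rootM rz orbT.
Qed.

Lemma christoffel_interlace n P : many_odd_zeros L n -> normal_index L' n ->
  orthogonal L n P -> (size P <= (mi_norm n).+2)%N -> ~~ root P z0 ->
  interlace (('X - z0%:P) * typeII_poly L' n) P.
Proof.
move=> mz nn' oP sP rP.
have [Qm [sQ oQ]] := typeII_polyP _ _ christoffel_linear nn'.
set Q := typeII_poly L' n in Qm sQ oQ *.
have Q0 := monic_neq0 Qm.
apply: (interlace_orthogonal _ n) => //.
- exact: christoffel_orthogonal.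
- by rewrite size_XsubC_mul.
move=> a b ab; apply/negP => /eqP e.
(* Evaluation at [z0] isolates the term in [P], which does not vanish there. *)
have b0 : b = 0.
  have /(congr1 (horner^~ z0)) := e.
  rewrite hornerD !hornerZ hornerM hornerXsubC subrr mul0r mulr0 add0r horner0.
  by move=> /eqP; rewrite mulf_eq0 -(rootE P) (negPf rP) orbF => /eqP.
move: ab e; rewrite b0 eqxx orbF scale0r addr0 => a0 /eqP.
by rewrite scaler_eq0 (negPf a0) mulf_eq0 polyXsubC_eq0 (negPf Q0).
Qed.

End Christoffel.
End TypeIIPolynomials.

(** * Supports of measures and integrals of polynomials *)

Section Moments.
Context {R : realType}.
Local Notation meas := {measure set (measurableTypeR R) -> \bar R}.
Implicit Types (m : meas) (P : {poly R}).

Lemma integrable_poly m P : finite_moments m ->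
  m.-integrable [set: R] (fun x : R => P.[x]%:E).
Proof.
move=> fm.
rewrite [X in _.-integrable _ X](_ : _ =
    (fun x : R => \sum_(i < size P) (P`_i)%:E * (x ^+ i)%:E)%E); last first.
  apply/funext => x; rewrite horner_coef -sumEFin.
  by apply: eq_bigr => i _; rewrite EFinM.
apply: integrable_sum => // i _; apply: integrableZl => //; exact: fm.
Qed.

(** A point outside the support lies in a null open interval with rational endpoints, and these
    intervals are countably many. *)
Lemma support_null m : m.-negligible (~` msupp m).
Proof.
(* Enumeration of the rational intervals; codes of no pair and intervals of nonzero measure are sent
   to [set0]. *)
pose F k : set (measurableTypeR R) :=
    if @choice.unpickle (rat * rat)%type k is Some (p, q)
  then if m `]ratr p, ratr q[%classic == 0%E then `]ratr p, ratr q[%classic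
       else set0
  else set0.
apply: (@negligibleS _ (measurableTypeR R) _ m (\bigcup_k F k)); last first.
  apply: negligible_bigcup => k; rewrite /F.
  case: choice.unpickle => [[p q]|]; last exact: negligible_set0.
  case: ifPn => [/eqP m0|_]; last exact: negligible_set0.
  by apply/negligibleP => //; exact: measurable_itv.
move=> x nx.
have [U oU [Ux mU]] : exists2 U : set R, open U & U x /\ m U = 0%E.
  apply: contrapT => h; apply: nx => U oU Ux.
  rewrite lt_neqAle measure_ge0 andbT; apply/eqP => /esym mU.
  by apply: h; exists U.
have /nbhs_ballP[e /= e0 eU] : nbhs x U by exact: open_nbhs_nbhs.
have [p] := @rat_in_itvoo R (x - e) x ltac:(lra).
rewrite in_itv /= => /andP[p1 p2].
have [q] := @rat_in_itvoo R x (x + e) ltac:(lra).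
rewrite in_itv /= => /andP[q1 q2].
have sU : `]ratr p, ratr q[%classic `<=` U.
  move=> y /=; rewrite in_itv /= => /andP[y1 y2]; apply: eU.
  by rewrite /ball /= ltr_norml; apply/andP; split; lra.
have m0 : m `]ratr p, ratr q[%classic = 0%E.
  apply: (@subset_measure0 _ (measurableTypeR R) _ m) sU mU;
      first exact: measurable_itv.
  exact: open_measurable.
exists (choice.pickle (p, q)); first exact: I.
by rewrite /F choice.pickleK m0 eqxx /= in_itv /= p2 q1.
Qed.

Lemma open_support_pos m (U : set R) x :
  open U -> U x -> msupp m x -> m.-negligible U -> False.
Proof.
move=> oU Ux sx /(@negligibleP _ (measurableTypeR R) _ m _ (open_measurable oU)) mU.
by have := sx U oU Ux; rewrite mU ltxx.
Qed.

Lemma open_nonroots P : open [set x : R | ~~ root P x].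
Proof.
have -> : [set x : R | ~~ root P x] = (horner P) @^-1` [set~ 0].
  by apply/seteqP; split=> x /= /eqP.
apply: open_comp => [x _|]; first exact: continuous_horner.
exact/closed_openC/accessible_closed_set1/hausdorff_accessible/Rhausdorff.
Qed.

(** Since the complement of the support is null, [P] is nonnegative almost everywhere; having
    integral 0, it vanishes almost everywhere. The open set where [P] is nonzero is thus null and
    misses the support. *)
Lemma support_roots m P : finite_moments m ->
  (forall x, msupp m x -> 0 <= P.[x]) -> \int[m]_x P.[x] = 0 ->
  forall x, msupp m x -> root P x.
Proof.
move=> fm P0 iP x sx; apply: contrapT => /negP rx.
apply: (@open_support_pos m _ x (open_nonroots P)) => //.
have ip := integrable_poly m P fm.
have mP : measurable_fun [set: R] (fun x : R => P.[x]%:E).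
  exact: (measurable_int _ ip).
have i0 : (\int[m]_x `|P.[x]%:E|)%E = 0%E.
  have -> : (\int[m]_x `|P.[x]%:E|)%E = (\int[m]_x P.[x]%:E)%E.
    apply: ae_eq_integral => //; first exact: measurableT_comp.
    apply: (@negligibleS _ (measurableTypeR R) _ m) (support_null m) =>
        y /= h sy; apply: h => _.
    by rewrite ger0_norm // P0.
  by rewrite -(fineK (integrable_fin_num _ ip)) //; rewrite /Rintegral in iP;
      rewrite iP.
have /ae_eq_integral_abs := i0; move=> /(_ measurableT mP).
apply: (@negligibleS _ (measurableTypeR R) _ m) => y /= ry /(_ I) [/eqP].
by rewrite -rootE (negPf ry).
Qed.

End Moments.

(** * Counting points of sets and zeros of polynomials *)

Section Cardinality.
Context {R : realType}.

Lemma card_le_seq (A : set R) n : (`I_n #<= A)%card ->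
  exists rs : seq R, [/\ uniq rs, size rs = n & forall x, x \in rs -> A x].
Proof.
move=> /pcard_leP[f]; pose g (i : nat) : R := f i; exists (map g (iota 0 n)).
split.
- rewrite map_inj_in_uniq ?iota_uniq // => i j; rewrite !mem_iota /= => i0 j0.
  by apply: 'inj_f; rewrite inE /=.
- by rewrite size_map size_iota.
- move=> x /mapP[k]; rewrite mem_iota /= => k0 ->.
  exact: (@funS _ _ _ _ f k).
Qed.

Lemma card_le_succ (A : set R) n : (`I_n #<= A)%card -> ~~ (A #= `I_n)%card ->
  (`I_n.+1 #<= A)%card.
Proof.
move=> nA neq; have [/finite_setP[m Am]|/infiniteP iA] :=
    pselect (finite_set A).
  move: nA neq; rewrite (card_le_eqr Am) (card_eql Am) card_le_II => nm mn.
  rewrite (card_le_eqr Am) card_le_II ltn_neqAle nm andbT.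
  by apply: contraNneq mn => ->; exact: card_eqxx.
by apply: card_le_trans iA; exact: subset_card_le.
Qed.

Lemma root_seq (T : {poly R}) : T != 0 ->
  exists2 rs : seq R, uniq rs & forall x, (x \in rs) = root T x.
Proof.
have [n] := ubnP (size T); elim: n T => // n IH T sT T0.
have [[x rx]|nr] := pselect (exists x, root T x); last first.
  exists [::] => // x; rewrite in_nil; apply/esym/negbTE/negP => rx.
  by apply: nr; exists x.
have /factor_theorem[Q Td] := rx.
have Q0 : Q != 0 by apply: contraNneq T0 => h; rewrite Td h mul0r.
have [|rs u rsP] := IH Q _ Q0.
  by move: sT; rewrite Td size_mul ?polyXsubC_eq0 // size_XsubC addn2.
exists (undup (x :: rs)); first exact: undup_uniq.
by move=> y; rewrite mem_undup in_cons Td rootM root_XsubC rsP orbC.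
Qed.

Lemma finite_roots (T : {poly R}) : T != 0 -> finite_set [set x | root T x].
Proof.
move=> T0; have [rs _ rsP] := root_seq _ T0.
have -> : [set x | root T x] = [set` rs] by apply/seteqP; split=> x /=;
    rewrite rsP.
exact: finite_seq.
Qed.

End Cardinality.

(** * Removal of sign changes *)

Section OddRoots.
Context {R : realType}.

Lemma mup_odd_root (T : {poly R}) x : odd (mup x T) -> root T x.
Proof. by apply: contraTT => nr; rewrite mupNroot. Qed.

(** Multiplication by one linear factor for each odd zero in [S] leaves only zeros of even order
    there, so no sign change on [D]. For Angelesco systems [S] is the relative interior of [D],
    which keeps the zeros of different measures apart. *)
Lemma odd_roots_sign (T : {poly R}) (D S : set R) : T != 0 ->
  (forall x y z, D x -> D y -> x < z < y -> S z) ->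
  exists zs : seq R, [/\ uniq zs,
    forall z, z \in zs -> S z /\ odd (mup z T) &
    exists2 c, c != 0 &
      forall x, D x -> 0 <= c * (T * \prod_(z <- zs) ('X - z%:P)).[x]].
Proof.
move=> T0 DS; have [rs u rsP] := root_seq _ T0.
pose zs := [seq x <- rs | `[< S x >] && odd (mup x T)].
have zsP z : z \in zs <-> S z /\ odd (mup z T).
  rewrite mem_filter rsP; split.
    by move=> /andP[/andP[/asboolP]].
  by move=> [Sz oz]; rewrite oz andbT mup_odd_root // andbT; exact/asboolP.
exists zs; split; [exact: filter_uniq|by move=> z /zsP|].
set Q := T * _.
have noodd x : S x -> ~~ odd (mup x Q).
  move=> Sx; rewrite /Q mupM //; last by rewrite monic_neq0 // monic_prod_XsubC.
  rewrite mu_prod_XsubC count_uniq_mem ?filter_uniq // oddD oddb.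
  case o : (odd (mup x T)).
    by have -> : x \in zs by apply/zsP.
  by case: (boolP (x \in zs)) => // /zsP[]; rewrite o.
have same x y : D x -> D y -> x < y -> 0 <= Q.[x] * Q.[y].
  move=> Dx Dy xy; rewrite leNgt; apply/negP => /(odd_root_between _ _ _ xy).
  by move=> [z zxy]; apply/negP/noodd; exact: DS zxy.
(* The constant is any nonzero value of [Q] on [D]; if there is none, 1 will do. *)
have [[x0 [Dx0 Qx0]]|h] := pselect (exists x, D x /\ Q.[x] != 0); last first.
  exists 1; first exact: oner_neq0.
  move=> x Dx; rewrite mul1r; have [->//|Qx] := eqVneq Q.[x] 0.
  by case: h; exists x.
exists Q.[x0] => // x Dx.
have [xx|xx|->] := ltgtP x x0; last by rewrite -expr2 sqr_ge0.
- by rewrite mulrC same.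
- by rewrite same.
Qed.

End OddRoots.

(** * Zeros of orthogonal polynomials for Angelesco systems *)

Section Angelesco.
Context {R : realType}.
Local Notation meas := {measure set (measurableTypeR R) -> \bar R}.

Lemma is_interval_hull (A : set R) : is_interval (hull A).
Proof. exact: interval_is_interval. Qed.

Lemma sub_hull (A : set R) : A `<=` hull A.
Proof. exact: sub_Rhull. Qed.

Lemma interval_interior (D : set R) a b z : is_interval D -> D a -> D b ->
  a < z < b -> D° z.
Proof.
move=> iD Da Db azb; have : nbhs z `]a, b[%classic.
  by apply: near_in_itvoo; rewrite in_itv.
by apply: filterS => y /=; rewrite in_itv /= => /andP[ay yb];
  apply: (iD a b) => //; rewrite !ltW.
Qed.

Lemma system_linear s (mu : 'I_s -> meas) :
  (forall j, finite_moments (mu j)) -> poly_linear (system mu).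
Proof.
move=> fm j a P T; rewrite /system.
rewrite -RintegralZl //; last exact: integrable_poly.
rewrite -RintegralD //; [|rewrite /comp|exact: integrable_poly].
  by apply: eq_Rintegral => x _; rewrite hornerD hornerZ.
rewrite [X in _.-integrable _ X](_ : _ = fun x : R => (a *: P).[x]%:E).
  exact: integrable_poly.
by apply/funext => x; rewrite hornerZ.
Qed.

Lemma christoffel_system s (mu : 'I_s -> meas) z0 j (P : {poly R}) :
  christoffel mu z0 j (horner P) = system mu j (horner (('X - z0%:P) * P)).
Proof.
apply: eq_Rintegral => x _.
by rewrite hornerM hornerXsubC mulrC.
Qed.

(** With fewer than [n j] odd zeros, the factor that removes the sign changes has degree below
    [n j]. Its product with [T] integrates to 0 and is nonnegative on the support, so it vanishes
    there; the added zeros are zeros of [T] already. *)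
Lemma orthogonal_odd_roots s (mu : 'I_s -> meas) n j (T : {poly R}) :
  (forall j, finite_moments (mu j)) -> T != 0 -> orthogonal (system mu) n T ->
  (exists zs : seq R, [/\ uniq zs, (n j <= size zs)%N &
     forall z, z \in zs -> relint (hull (msupp (mu j))) z /\ odd (mup z T)]) \/
  (forall x, msupp (mu j) x -> root T x).
Proof.
move=> fm T0 oT; set D := hull (msupp (mu j)).
have [|zs [u zsP [c c0 cP]]] := odd_roots_sign _ D (relint D) T0.
  by move=> x y z Dx Dy xzy; left; apply: interval_interior xzy => //;
    exact: is_interval_hull.
have [nz|zn] := leqP (n j) (size zs); first by left; exists zs.
right; have lin := system_linear _ _ fm.
set Q := \prod_(z <- zs) ('X - z%:P) in cP.
have i0 : \int[mu j]_x (T * (c *: Q)).[x] = 0.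
  apply: (orthogonal_poly _ _ _ _ _ lin oT).
  by rewrite size_scale // size_prod_XsubC.
move=> x sx; have := support_roots _ _ (fm j) _ i0 x sx.
rewrite -scalerAr; have P0 y : msupp (mu j) y -> 0 <= (c *: (T * Q)).[y].
  by move=> sy; rewrite hornerZ; apply: cP; exact: sub_hull.
move=> /(_ P0); rewrite rootZ // rootM => /orP[//|].
by rewrite root_prod_XsubC => /zsP[_]; exact: mup_odd_root.
Qed.

(** If the hull of [mu i] is the point [x], both supports are finite and the hulls are disjoint. If
    [x] is an interior point, either the other hull is the point [x], its own relative interior, or
    moving slightly from [x] into that hull reaches both interiors. *)
Lemma angelesco_relint_hull s (mu : 'I_s -> meas) i j x : angelesco mu ->
  i != j -> finite_set (msupp (mu j)) ->
  relint (hull (msupp (mu i))) x -> hull (msupp (mu j)) x -> False.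
Proof.
move=> ang ij fj; have [dr dh] := ang i j ij.
set Di := hull (msupp (mu i)) in dr dh *; set Dj :=
    hull (msupp (mu j)) in dr dh *.
move=> [ix jx|/= ix jx]; last first.
  have : (Di `&` Dj) x by split => //; rewrite ix.
  rewrite dh //; apply: sub_finite_set (finite_set1 x).
  by rewrite -ix; exact: sub_hull.
have [e|ne] := pselect (Dj = [set x]).
  have : (relint Di `&` relint Dj) x by split; [left|right].
  by rewrite dr.
have [y jy yx] : exists2 y, Dj y & y != x.
  apply: contrapT => h; apply: ne; apply/seteqP; split=> [y jy|_ -> //].
  by apply: contrapT => /eqP yx; apply: h; exists y.
have /nbhs_ballP[e /= e0 eI] : nbhs x Di° by apply: open_nbhs_nbhs;
    split => //; exact: open_interior.
have iDj : is_interval Dj by exact: is_interval_hull.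
suff [z zi zj] : exists2 z, Di° z & Dj° z.
  have : (relint Di `&` relint Dj) z by split; left.
  by rewrite dr.
(* A step of length [d] from [x] towards [y] stays in the ball and stops strictly before [y]. *)
pose d := Num.min (e / 2) (`|y - x| / 2).
have yx0 : 0 < `|y - x| by rewrite normr_gt0 subr_eq0.
have d0 : 0 < d by rewrite lt_min !divr_gt0.
have de : d < e by rewrite gt_min; apply/orP; left; lra.
have dy : d < `|y - x| by rewrite gt_min; apply/orP; right; lra.
have [xy|xy] := ltP x y.
  rewrite gtr0_norm ?subr_gt0 // in dy; exists (x + d).
    by apply: eI; rewrite /ball /= opprD addNKr normrN gtr0_norm.
  by apply: (interval_interior _ x y) => //; apply/andP; split; lra.
have {}xy : y < x by rewrite lt_neqAle yx.
rewrite ltr0_norm ?subr_lt0 // in dy; exists (x - d).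
  by apply: eI; rewrite /ball /= opprB addrCA subrr addr0 gtr0_norm.
by apply: (interval_interior _ y x) => //; apply/andP; split; lra.
Qed.

Lemma flatten_disjoint s (Z : 'I_s -> seq R) : (forall j, uniq (Z j)) ->
  (forall i j x, i != j -> x \in Z i -> x \in Z j -> False) ->
  exists rs, [/\ uniq rs, size rs = (\sum_j size (Z j))%N &
    forall x, x \in rs -> exists j, x \in Z j].
Proof.
move=> uZ dZ; exists [seq x | j <- enum 'I_s, x <- Z j]; split.
- apply: allpairs_uniq_dep; first exact: enum_uniq.
    by move=> j _; exact: uZ.
  move=> u v /allpairsPdep[a [x [_ xa ->]]] /allpairsPdep[b [y [_ yb ->]]] /=.
  move=> xy; rewrite -{y}xy in yb *; have [->//|ab] := eqVneq a b.
  by case: (dZ a b x ab xa yb).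
- by rewrite size_allpairs_dep sumnE big_map big_enum.
- by move=> x /allpairsPdep[j [y [_ jy ->]]]; exists j.
Qed.

(** Each measure contributes either [n j] odd zeros or [e j] points of its support, and the
    contributions are disjoint. The choice [e = n] counts zeros, and [e = n + 1] yields the extra
    zero at unsaturated indices. *)
Lemma angelesco_zeros s (mu : 'I_s -> meas) (n e : 'I_s -> nat) (T : {poly R}) :
  (forall j, finite_moments (mu j)) -> angelesco mu ->
  (forall j, `I_(e j) #<= msupp (mu j))%card ->
  T != 0 -> orthogonal (system mu) n T ->
  exists rs, [/\ uniq rs, all (root T) rs &
    exists2 N : 'I_s -> nat, size rs = (\sum_j N j)%N &
      (forall j, n j <= N j)%N /\ all (fun x => odd (mup x T)) rs \/
      (forall j, n j <= N j \/ e j <= N j)%N /\ (exists j, e j <= N j)%N].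
Proof.
move=> fm ang eP T0 oT.
pose odd_set j (Z : seq R) := (n j <= size Z)%N /\
  forall z, z \in Z -> relint (hull (msupp (mu j))) z /\ odd (mup z T).
pose supp_set j (Z : seq R) := [/\ size Z = e j,
  forall x, msupp (mu j) x -> root T x & forall z, z \in Z -> msupp (mu j) z].
have /choice[Z ZP] j : exists Z, uniq Z /\ (odd_set j Z \/ supp_set j Z).
  have [[Z [uZ nZ ZP]]|sT] := orthogonal_odd_roots _ _ _ j _ fm T0 oT.
    by exists Z; split => //; left.
  have [Z [uZ sZ ZP]] := card_le_seq _ _ (eP j).
  by exists Z; split => //; right.
(* A support on which the nonzero [T] vanishes is finite, which gives access to the disjointness of
   the hulls. *)
have fs j : supp_set j (Z j) -> finite_set (msupp (mu j)).
  by move=> [_ sT _]; apply: sub_finite_set (finite_roots _ T0).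
have dZ i j x : i != j -> x \in Z i -> x \in Z j -> False.
  move=> ij xi xj; have ji : j != i by rewrite eq_sym.
  have [dr dh] := ang i j ij.
  have [[_ [oi|si]] [_ [oj|sj]]] := (ZP i, ZP j).
  - have [_ /(_ x xi)[ix _]] := oi; have [_ /(_ x xj)[jx _]] := oj.
    suff : set0 x by []; rewrite -dr; by split.
  - have [_ /(_ x xi)[ix _]] := oi; have [_ _ /(_ x xj)/sub_hull jx] := sj.
    by apply: (angelesco_relint_hull _ _ _ _ _ ang ij (fs j sj) ix jx).
  - have [_ /(_ x xj)[jx _]] := oj; have [_ _ /(_ x xi)/sub_hull ix] := si.
    by apply: (angelesco_relint_hull _ _ _ _ _ ang ji (fs i si) jx ix).
  - have [_ _ /(_ x xi)/sub_hull ix] := si.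
    have [_ _ /(_ x xj)/sub_hull jx] := sj.
    suff : set0 x by []; rewrite -(dh (fs i si) (fs j sj)); by split.
have [rs [u srs rsP]] := flatten_disjoint _ Z (fun j => proj1 (ZP j)) dZ.
exists rs; split => //.
  apply/allP => x /rsP[j xj]; have [_ [[_ /(_ x xj)[_]]|]] := ZP j.
    exact: mup_odd_root.
  by move=> [_ sT /(_ x xj)/sT].
exists (fun j => size (Z j)) => //.
have [ao|] := pselect (forall j, odd_set j (Z j)).
  left; split; first by move=> j; have [] := ao j.
  by apply/allP => x /rsP[j xj]; have [_ /(_ x xj)[]] := ao j.
move=> /existsNP[j nj]; right; split.
  by move=> i; have [_ [[]|[->]]] := ZP i; [left|right].
by exists j; have [_ [//|[->]]] := ZP j.
Qed.

Lemma angelesco_many_zeros s (mu : 'I_s -> meas) n :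
  (forall j, finite_moments (mu j)) -> angelesco mu -> box mu n ->
  many_zeros (system mu) n.
Proof.
move=> fm ang nb T T0 oT.
have [rs [u rr [N srs NP]]] := angelesco_zeros _ _ n _ _ fm ang nb T0 oT.
exists rs; split => //; rewrite srs; apply: leq_sum => j _.
by case: NP => [[+ _]|[+ _]] => /(_ j) => [|[]].
Qed.

Lemma angelesco_many_odd_zeros s (mu : 'I_s -> meas) n :
  (forall j, finite_moments (mu j)) -> angelesco mu -> box mu n ->
  (forall i, ~~ saturated mu n i) -> many_odd_zeros (system mu) n.
Proof.
move=> fm ang nb ns T T0 oT.
have nb' j : (`I_(n j).+1 #<= msupp (mu j))%card.
  by apply: card_le_succ; [exact: nb | exact: ns].
have [rs [u rr [N srs NP]]] := angelesco_zeros _ _ n _ _ fm ang nb' T0 oT.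
exists rs => //; case: NP => [[nN o]|[nN [j jN]]]; [left|right]; split => //.
  by rewrite srs; apply: leq_sum.
(* The measure [j] supplies one zero more than [n j], and the others at least their share. *)
rewrite srs /mi_norm (bigD1 j) //= [X in (_ < X)%N](bigD1 j) //= -addSn.
apply: leq_add => //; apply: leq_sum => i _.
by case: (nN i) => // /ltnW.
Qed.

End Angelesco.

(** * Sign patterns of combinations of a Chebyshev system *)

Section ChebyshevSign.
Context {R : realType}.

Lemma within_ivt (A : set R) (f : R -> R) a b : is_interval A ->
  {within A, continuous f} -> A a -> A b -> f a * f b < 0 ->
  exists2 c, A c & f c = 0.
Proof.
move=> iA cf; wlog ab : a b / a <= b => [H Aa Ab fab|Aa Ab fab].
  have [ab|/ltW ba] := leP a b; first exact: (H a b).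
  by apply: (H b a) => //; rewrite mulrC.
have sA : `[a, b]%classic `<=` A.
  by move=> x /=; rewrite in_itv /= => /andP[ax xb]; apply: (iA a b) => //;
      rewrite ax.
have [||c cab fc] := @IVT R f a b 0 ab.
- exact: continuous_subspaceW cf.
- have [fa|fa|fa] := ltgtP (f a) 0.
  + have fb : 0 < f b by move: fab; rewrite nmulr_rlt0.
    by rewrite ge_min le_max (ltW fa) (ltW fb) orbT.
  + have fb : f b < 0 by move: fab; rewrite pmulr_rlt0.
    by rewrite ge_min le_max (ltW fa) (ltW fb) orbT.
  + by move: fab; rewrite fa mul0r ltxx.
by exists c => //; apply: sA.
Qed.

Section Determinant.
Variables (n : nat) (D : set R) (f : 'I_n -> R -> R).
Hypothesis iD : is_interval D.
Hypothesis cf : forall t, {within D, continuous (f t)}.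
Hypothesis haar : forall (c : 'I_n -> R) (y : 'I_n -> R),
  injective y -> (forall i, D (y i)) ->
  (forall i, \sum_t c t * f t (y i) = 0) -> forall t, c t = 0.

Definition alternant (y : 'I_n -> R) := \det (\matrix_(i, t) f t (y i)).

Lemma alternant_neq0 y : injective y -> (forall i, D (y i)) ->
  alternant y != 0.
Proof.
move=> iy Dy; rewrite /alternant -det_tr; apply/det0P => -[v v0 vA].
have c0 := haar (fun t => v 0 t) y iy Dy.
have {}c0 : forall t, v 0 t = 0.
  apply: c0 => i; have /matrixP /(_ 0 i) := vA; rewrite mxE [RHS]mxE => {2}<-.
  by apply: eq_bigr => t _; rewrite !mxE.
by move/eqP: v0; apply; apply/rowP => t; rewrite c0 mxE.
Qed.

Definition increasing (y : 'I_n -> R) :=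
    forall i j : 'I_n, (i < j)%N -> y i < y j.

Lemma increasing_inj y : increasing y -> injective y.
Proof.
move=> iy i j yij; have [/iy|/iy|] := ltngtP i j; last exact: val_inj.
  by rewrite yij ltxx.
by rewrite yij ltxx.
Qed.

(* The increasing n-tuples in an interval form a convex set, on which the
   alternant has no zero. *)
Lemma alternant_sign y y' : increasing y -> increasing y' ->
  (forall i, D (y i)) -> (forall i, D (y' i)) ->
  0 < alternant y * alternant y'.
Proof.
move=> iy iy' Dy Dy'.
(* The segment from [y] to [y']: its tuples remain increasing and in [D], so a sign change of the
   alternant along it would give a zero. *)
pose h (i : 'I_n) (t : R) : R := (1 - t) * y i + t * y' i.
have h01 i t : `[0, 1]%classic t -> D (h i t).
  rewrite /= in_itv /= => /andP[t0 t1].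
  have t1' : 0 <= 1 - t by rewrite subr_ge0.
  have [yy|/ltW yy] := leP (y i) (y' i); rewrite -subr_ge0 in yy;
      have e0 := mulr_ge0 t0 yy; have e1 := mulr_ge0 t1' yy.
    by apply: (iD (y i) (y' i)) => //; apply/andP; split; rewrite /h; lra.
  by apply: (iD (y' i) (y i)) => //; apply/andP; split; rewrite /h; lra.
have hinc t : `[0, 1]%classic t -> increasing (h^~ t).
  rewrite /= in_itv /= => /andP[t0 t1] i j ij; rewrite /h.
  have t1' : 0 <= 1 - t by rewrite subr_ge0.
  have yij := iy i j ij; have yij' := iy' i j ij.
  have [->|tn0] := eqVneq t 0; first by lra.
  have tp : 0 < t by rewrite lt_neqAle eq_sym tn0.
  apply: ler_ltD; first by rewrite ler_wpM2l // ltW.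
  by rewrite ltr_pM2l.
have ch i : continuous (h i).
  have -> : h i = horner ((y i)%:P + (y' i - y i) *: 'X).
    by apply/funext => t; rewrite /h hornerD hornerZ hornerC hornerX; lra.
  exact: continuous_horner.
pose g t := alternant (h^~ t).
have cg : {within `[0, 1]%classic, continuous g}.
  apply/subspace_continuousP => t t01.
  have FF : Filter (within `[0, 1]%classic (nbhs t)) by exact: within_filter.
  (* Continuity of [f i] holds only relative to [D]; the composition is legitimate because [h] stays
     in [D] for parameters in the unit interval. *)
  have cfh i j : f i (h j x) @[x --> within `[0, 1]%classic (nbhs t)] --> f i (h j t).
    have /subspace_continuousP /(_ (h j t) (h01 j t t01)) cfD := cf i.
    apply: cvg_comp cfD => B hB.
    have : nbhs t (h j @^-1` [set z | D z -> B z]) by exact: ch.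
    by apply: filterS => z /= hz z01; apply: hz; exact: h01.
  rewrite /g /alternant /determinant.
  apply: cvg_big => [|s _]; first exact: add_continuous.
  apply: cvgM; first exact: cvg_cst.
  apply: cvg_big => [|i _]; first exact: mul_continuous.
  rewrite mxE; under eq_fun do rewrite mxE; exact: cfh.
have h0 : h^~ 0 = y by apply/funext => i; rewrite /h subr0 mul1r mul0r addr0.
have h1 : h^~ 1 = y' by apply/funext => i; rewrite /h subrr mul1r mul0r add0r.
rewrite lt_neqAle eq_sym mulf_neq0 ?alternant_neq0 //=;
  try exact: increasing_inj.
rewrite leNgt; apply/negP => neg.
have [|||t t01] :=
    @within_ivt `[0, 1]%classic g 0 1 (@interval_is_interval _ _) cg.
- by rewrite /= in_itv /= lexx ler01.
- by rewrite /= in_itv /= lexx ler01.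
- by rewrite /g h0 h1.
apply/eqP/alternant_neq0; first exact: increasing_inj (hinc t t01).
by move=> i; exact: h01.
Qed.

End Determinant.

(** Insert [x] at its sorted place among the [zs]. The alternant of this increasing tuple has
    constant sign, and its expansion along the row of [x] is a fixed combination of the [f t x]
    times the sign of the position of [x]. That sign changes exactly as the product over [zs]
    does. *)
Lemma chebyshev_sign_pattern (n : nat) (D : set R) (f : 'I_n -> R -> R)
    (zs : seq R) : is_interval D ->
  (forall t, {within D, continuous (f t)}) ->
  (forall (c : 'I_n -> R) (y : 'I_n -> R),
    injective y -> (forall i, D (y i)) ->
    (forall i, \sum_t c t * f t (y i) = 0) -> forall t, c t = 0) ->
  n = (size zs).+1 -> uniq zs -> (forall z, z \in zs -> D z) ->
  exists c : 'I_n -> R, forall x, D x -> x \notin zs ->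
    0 < (\sum_t c t * f t x) * (\prod_(z <- zs) ('X - z%:P)).[x].
Proof.
move=> iD cf haar; wlog szs : zs / sorted <%R zs => [H nz uz Dz|].
  have [||||c cP] := H (sort <=%R zs).
  - by rewrite sort_lt_sorted.
  - by rewrite size_sort.
  - by rewrite sort_uniq.
  - by move=> z; rewrite mem_sort; exact: Dz.
  exists c => x Dx xz; rewrite -(perm_big _ (permEl (perm_sort <=%R zs))) /=.
  by apply: cP => //; rewrite mem_sort.
set m := size zs => nz _ Dz; subst n.
have /andP[_ sle] : uniq zs && sorted <=%R zs by rewrite -lt_sorted_uniq_le.
(* The number of points of [zs] below [x], possibly [m]; hence the type ['I_m.+1]. *)
pose pos x := find (fun z => x <= z) zs.
have pos_lt x : (pos x < m.+1)%N by rewrite ltnS find_size.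
pose p x : 'I_m.+1 := Ordinal (pos_lt x).
have below x a : (a < p x)%N -> nth 0 zs a < x.
  by move=> /(before_find 0) /negbT; rewrite -ltNge.
have above x a : x \notin zs -> (a < m)%N -> (p x <= a)%N -> x < nth 0 zs a.
  move=> xz am pa; rewrite lt_neqAle; apply/andP; split.
    by apply: contraNneq xz => ->; exact: mem_nth.
  have hs : has (fun z => x <= z) zs by rewrite has_find;
      exact: leq_ltn_trans pa am.
  apply: le_trans (nth_find 0 hs) _.
  apply: (sorted_leq_nth le_trans le_refl 0 sle) => //.
  by rewrite inE -has_find.
pose y x (i : 'I_m.+1) := if unlift (p x) i is Some a then nth 0 zs a else x.
have yinc x : x \notin zs -> increasing m.+1 (y x).
  move=> xz i j; rewrite /y; case: unliftP => [a ->|->]; case: unliftP =>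
      [b ->|->].
  - rewrite /= !ltnNge leq_bump2 -ltnNge => ab.
    by apply: (sorted_ltn_nth lt_trans 0 szs) => //; rewrite inE.
  - move=> ap; apply: below; move: ap; rewrite /= /bump; case: leqP => //; lia.
  - move=> pb; apply: above => //; move: pb; rewrite /= /bump;
      case: leqP => //; lia.
  - by rewrite ltnn.
have yD x i : D x -> D (y x i).
  by move=> Dx; rewrite /y; case: unliftP => [a _|_] //; apply/Dz/mem_nth.
(* Deleting the row of [x] leaves the points [zs] only, so these minors do not depend on [x]. *)
pose C (t : 'I_m.+1) : R :=
  (-1) ^+ t * \det (\matrix_(i < m, u < m) f (lift t u) (nth 0 zs i)).
have altE x : alternant _ f (y x) = (-1) ^+ p x * \sum_t C t * f t x.
  rewrite /alternant (expand_det_row _ (p x)) mulr_sumr; apply: eq_bigr => t _.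
  rewrite mxE /y unlift_none /cofactor exprD mulrC !mulrA; congr (_ * _ * _).
  by congr (\det _); apply/matrixP => i u; rewrite !mxE liftK.
have prodE x : x \notin zs ->
    0 < (-1) ^+ (m - p x) * (\prod_(z <- zs) ('X - z%:P)).[x].
  move=> xz; rewrite horner_prod -{1}(cat_take_drop (p x) zs) big_cat /=.
  rewrite mulrCA mulr_gt0 //.
    rewrite big_seq prodr_gt0 // => z /(nthP 0)[a].
    rewrite size_take_min leq_min => /andP[ap _].
    by rewrite nth_take // => <-; rewrite hornerXsubC subr_gt0 below.
  have above' z : z \in drop (p x) zs -> x < z.
    move=> /(nthP 0)[a]; rewrite size_drop nth_drop => am <-.
    by apply: above; rewrite ?leq_addr // -ltn_subRL.
  rewrite -size_drop; elim: (drop _ _) above' => [|z r IH] ab.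
    by rewrite expr0 big_nil mul1r ltr01.
  rewrite big_cons exprS mulrACA mulr_gt0 ?IH //.
    by rewrite hornerXsubC mulN1r opprB subr_gt0 ab // mem_head.
  by move=> u ur; apply: ab; rewrite in_cons ur orbT.
have [[x0 [Dx0 xz0]]|h] := pselect (exists x, D x /\ x \notin zs); last first.
  by exists (fun=> 0) => x Dx xz; case: h; exists x.
(* The alternant at a reference point [x0] fixes the unknown constant sign; [(-1) ^+ m] accounts for
   the [m - p x] negative factors of the product. *)
exists (fun t => (-1) ^+ m * alternant _ f (y x0) * C t) => x Dx xz.
have pm : (p x <= m)%N by rewrite -ltnS.
have := alternant_sign _ _ _ iD cf haar _ _ (yinc x0 xz0) (yinc x xz)
  (fun i => yD x0 i Dx0) (fun i => yD x i Dx).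
move=> /mulr_gt0 /(_ (prodE x xz)); rewrite (altE x).
set q := (_.[x]); set F := \sum_t C t * f t x.
rewrite [X in _ -> 0 < X * _](_ : _ = (-1) ^+ m * alternant _ f (y x0) * F).
  have -> : (-1) ^+ m = (-1) ^+ p x * (-1) ^+ (m - p x) :> R.
    by rewrite -exprD subnKC.
  by congr (_ < _); ring.
rewrite /F; move: (_ * alternant _ _ _) => A.
by rewrite mulr_sumr; apply: eq_bigr => t _; rewrite -mulrA.
Qed.

End ChebyshevSign.

(** * Integration against a measure with a density *)

Section Density.
Context d (T : measurableType d) (R : realType).
Variables (nu m : {measure set T -> \bar R}) (D : set T) (w : T -> R).
Hypotheses (mD : measurable D) (mw : measurable_fun D w).
Hypothesis w0 : forall x, D x -> 0 <= w x.
Hypothesis nuE : forall A, measurable A ->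
  nu A = (\int[m]_(x in A `&` D) (w x)%:E)%E.

Import HBNNSimple.

(** For simple functions this is [nuE] on each level set; monotone convergence along increasing
    simple approximations gives the rest. *)
Lemma ge0_integral_density (f : T -> \bar R) : (forall x, 0 <= f x)%E ->
  measurable_fun setT f ->
  (\int[nu]_x f x = \int[m]_(x in D) (f x * (w x)%:E))%E.
Proof.
move=> f0 mf; have mwE : measurable_fun D (EFin \o w) by exact/measurable_EFinP.
pose h := nnsfun_approx measurableT mf.
rewrite (@nd_ge0_integral_lim _ _ _ nu f h) //; last 2 first.
- by move=> x a b ab; exact/lefP/nd_nnsfun_approx.
- by move=> x; apply: cvg_nnsfun_approx => // y _; exact: f0.
have mh n : measurable_fun D (EFin \o h n).
  by apply/measurable_EFinP; exact: measurable_funTS.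
transitivity (\int[m]_(x in D)
    limn (fun n => (h n x)%:E * (w x)%:E)%E)%E; last first.
  apply: eq_integral => x /[!inE] Dx; apply/cvg_lim => //.
  by apply: cvgeZr => //; apply: cvg_nnsfun_approx => // y _; exact: f0.
rewrite monotone_convergence //; last 3 first.
- by move=> n; exact: emeasurable_funM (mh n) mwE.
- by move=> n x Dx; rewrite mule_ge0 // lee_fin ?w0.
- move=> x Dx a b ab; apply: lee_wpmul2r; first by rewrite lee_fin w0.
  by rewrite lee_fin; exact/lefP/nd_nnsfun_approx.
congr (limn _); apply/funext => n /=; rewrite sintegralE.
transitivity (\int[m]_(x in D)
    \sum_(r \in range (h n)) ((r * \1_(h n @^-1` [set r]) x)%:E * (w x)%:E))%E;
    last first.
  apply: eq_integral => x _; rewrite -ge0_mule_fsuml.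
    by rewrite fsumEFin // -fimfunE.
  by move=> r; rewrite EFinM nnfun_muleindic_ge0.
have mi r : measurable_fun D (fun x => (\1_(h n @^-1` [set r]) x)%:E : \bar R).
  by apply/measurable_EFinP; exact: measurable_indic.
rewrite ge0_integral_fsum //; last 2 first.
- move=> r; apply: emeasurable_funM => //; under eq_fun do rewrite EFinM.
  exact: emeasurable_funM (measurable_cst _) (mi r).
- by move=> r x Dx; rewrite mule_ge0 ?lee_fin ?w0 // -lee_fin EFinM
    nnfun_muleindic_ge0.
apply: eq_fsbigr => r /[!inE] -[y _ yr].
under [RHS]eq_integral do rewrite EFinM -muleA.
rewrite ge0_integralZl //; last 3 first.
- exact: emeasurable_funM (mi r) mwE.
- by move=> x Dx; rewrite mule_ge0 ?lee_fin ?w0.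
- by rewrite lee_fin -yr.
congr (_ * _)%E; rewrite nuE // setIC integral_mkcondr epatch_indic.
by apply: eq_integral => x _; rewrite muleC.
Qed.

(** Multiplication by the nonnegative [w] commutes with absolute values and with positive and
    negative parts, which reduces both claims to the nonnegative case. *)
Lemma integrable_density (f : T -> R) : nu.-integrable setT (EFin \o f) ->
  m.-integrable D (fun x => (f x * w x)%:E) /\
  \int[nu]_x f x = \int[m]_(x in D) (f x * w x).
Proof.
move=> intf; have /integrableP[mf foo] := intf.
have mf' : measurable_fun D f.
  by apply: measurable_funTS; exact/measurable_EFinP.
have absE x : D x -> (`|(f x * w x)%:E| = `|(f x)%:E| * (w x)%:E)%E.
  by move=> Dx; rewrite /= normrM (ger0_norm (w0 _ Dx)) EFinM.
split.
  apply/integrableP; split.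
    by apply/measurable_EFinP; exact: measurable_funM.
  rewrite (eq_integral (fun x => `|(f x)%:E| * (w x)%:E)%E); last first.
    by move=> x /[!inE]; exact: absE.
  rewrite -ge0_integral_density //.
  exact: measurableT_comp.
rewrite /Rintegral; congr fine; rewrite integralE [RHS]integralE.
congr (_ - _)%E.
  rewrite ge0_integral_density //; last exact: measurable_funepos.
  apply: eq_integral => x /[!inE] Dx.
  by rewrite !funeposE maxe_pMl ?lee_fin ?w0 // mul0e -EFinM.
rewrite ge0_integral_density //; last exact: measurable_funeneg.
apply: eq_integral => x /[!inE] Dx.
by rewrite !funenegE maxe_pMl ?lee_fin ?w0 // mul0e mulNe -EFinM.
Qed.

End Density.

(** * Zeros of orthogonal polynomials for AT systems *)

Section ATSystems.
Context {R : realType}.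
Local Notation meas := {measure set (measurableTypeR R) -> \bar R}.

Lemma chebyshev_unisolvent (D : set R) (S : finType) (f : S -> R -> R)
    (c y : 'I_#|S| -> R) : chebyshev_system D f ->
  injective y -> (forall i, D (y i)) ->
  (forall i, \sum_t c t * f (enum_val t) (y i) = 0) -> forall t, c t = 0.
Proof.
move=> ch iy Dy cy t; apply/eqP/negPn/negP => ct.
have ex : exists u, c (enum_rank u) != 0 by exists (enum_val t);
    rewrite enum_valK.
have g := ch (fun u => c (enum_rank u)) ex;
    have : (`I_#|S| #<= `I_(#|S|.-1))%card.
  have yS : {in [set: 'I_#|S|] &, injective y} by move=> i j _ _; exact: iy.
  rewrite (card_le_eql card_II) -(card_le_eql (inj_card_eq yS)).
  apply: card_le_trans (subset_card_le _) g => _ [i _ <-]; split=> //=.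
  rewrite (reindex _ (onW_bij _ (enum_val_bij S))) /= -[RHS](cy i).
  by apply: eq_bigr => u _; rewrite enum_valK.
(* The element [t] shows that [#|S|] is positive, so its predecessor is truly smaller. *)
by rewrite card_le_II leqNgt prednK ?leqnn // (leq_ltn_trans _ (ltn_ord t)).
Qed.

(** Serves to select a Chebyshev system with exactly one function more than the sign changes to be
    imitated. *)
Lemma mi_norm_sub s (n : 'I_s -> nat) r : (r <= mi_norm n)%N ->
  exists2 n', (forall j, n' j <= n j)%N & mi_norm n' = r.
Proof.
elim: r => [_|r IH rn]; first by exists (fun=> 0%N) => //;
    rewrite /mi_norm big1.
have [n' n'n n'r] := IH (ltnW rn).
have [j jn] : exists j, (n' j < n j)%N.
  apply: contrapT => h; move: rn; rewrite -n'r ltnNge => /negP; apply.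
  by apply: leq_sum => j _; rewrite leqNgt; apply/negP => jn; apply: h;
      exists j.
exists (mi_succ n' j); last by rewrite mi_norm_succ n'r.
move=> i; rewrite /mi_succ; have [->|_] := eqVneq i j; first by rewrite addn1.
by rewrite addn0.
Qed.

Lemma Rintegral_sum_eq0 (m : meas) (D : set R) (J : Type) (r : seq J)
    (g : J -> R -> R) : measurable (D : set (measurableTypeR R)) ->
  (forall i, m.-integrable D (fun x : R => (g i x)%:E) /\
             \int[m]_(x in D) g i x = 0) ->
  m.-integrable D (fun x : R => (\sum_(i <- r) g i x)%:E) /\
  \int[m]_(x in D) (\sum_(i <- r) g i x) = 0.
Proof.
move=> mD gP; elim: r => [|i r [IH1 IH2]].
  under eq_fun do rewrite big_nil.
  split; first exact: integrable0.
  by under eq_Rintegral do rewrite big_nil; rewrite Rintegral_cst // mul0r.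
have [g1 g2] := gP i; split.
  under eq_fun do rewrite big_cons EFinD.
  exact: integrableD.
under eq_Rintegral do rewrite big_cons.
by rewrite RintegralD // IH2 g2 addr0.
Qed.

(** For the unit multi-index at [j] the Chebyshev system consists of [w j] alone and admits no
    zero. *)
Lemma AT_weight_neq0 s (D : set R) (w : 'I_s -> R -> R) j x :
  (forall n : 'I_s -> nat, (exists j, n j != 0%N) -> chebyshev_system D
     (fun (t : {j : 'I_s & 'I_(n j)}) (x : R) =>
        x ^+ tagged t * w (tag t) x)) ->
  D x -> w j x != 0.
Proof.
move=> ch Dx; apply/negP => /eqP wx; pose n i : nat := (i == j :> 'I_s).
have n0 : exists i, n i != 0%N by exists j; rewrite /n eqxx.
have ex : exists t : {i : 'I_s & 'I_(n i)}, 1 != 0 :> R.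
  have nj : (0 < n j)%N by rewrite /n eqxx.
  by exists (Tagged (fun i => 'I_(n i)) (Ordinal nj)); exact: oner_neq0.
have := ch n n0 (fun=> 1) ex.
have -> : #|{: {i : 'I_s & 'I_(n i)}}| = 1%N.
  by rewrite card_mi /mi_norm (bigD1 j) //= /n eqxx big1 // => i /negPf ->.
rewrite II0 card_le0 => /eqP e; suff : set0 x by [].
rewrite -e; split=> //=; apply: big1 => -[i p] _ /=.
have ij : i = j.
  by case: p => p; rewrite /n; have [->//|//] := eqVneq i j.
have -> : w i x = 0 by rewrite ij.
by rewrite !mulr0.
Qed.

(** A continuous weight without zeros has constant sign on the interval; a negative one would make
    the total mass of [mu j] nonpositive, against the nonempty support. *)
Lemma AT_weight_pos s (mu : 'I_s -> meas) (D : set R) (m : meas)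
    (w : 'I_s -> R -> R) j :
  is_interval D -> msupp (mu j) !=set0 -> {within D, continuous (w j)} ->
  (forall A : set R, measurable (A : set (measurableTypeR R)) ->
     mu j A = (\int[m]_(x in A `&` D) (w j x)%:E)%E) ->
  (forall x, D x -> w j x != 0) -> forall x, D x -> 0 < w j x.
Proof.
move=> iD [x0 sx0] cw muE w0 x Dx; rewrite lt_neqAle eq_sym w0 //= leNgt.
apply/negP => wx; have wle y : D y -> w j y <= 0.
  move=> Dy; rewrite leNgt; apply/negP => wy.
  have [|c Dc /eqP] := within_ivt _ _ _ _ iD cw Dx Dy.
    by rewrite nmulr_rlt0.
  by apply/negP; exact: w0.
have := sx0 setT openT I; rewrite muE //; apply/negP; rewrite -leNgt.
rewrite integralE [X in (X - _)%E]integral0_eq => [|y [_ Dy]].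
  by rewrite sub0e oppe_le0 integral_ge0.
by rewrite funeposE; apply/max_idPr; rewrite lee_fin wle.
Qed.

(** With fewer than [mi_norm n] odd zeros in [D], some combination of the [x^p w_j] allowed by [n]
    changes sign where [T] does. Its product with [T] has, up to a constant, a nonnegative sign and
    integral 0, so [T] vanishes [m]-almost everywhere on [D], hence on every support. *)
Lemma AT_odd_roots s (mu : 'I_s -> meas) n (T : {poly R}) :
  (forall j, finite_moments (mu j)) -> (forall j, msupp (mu j) !=set0) ->
  AT_system mu -> T != 0 -> orthogonal (system mu) n T ->
  (exists zs : seq R, [/\ uniq zs, (mi_norm n <= size zs)%N &
     all (fun z => odd (mup z T)) zs]) \/
  (forall j x, msupp (mu j) x -> root T x).
Proof.
move=> fm sne [D [m [w [iD _ cw muE ch]]]] T0 oT.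
have wpos j x : D x -> 0 < w j x.
  move=> Dx;
      apply: (AT_weight_pos _ mu D m w j iD (sne j) (cw j) (muE j)) => // y.
  exact: AT_weight_neq0 ch.
have [|zs [u zsP [a a0 aP]]] := odd_roots_sign _ D D T0.
  by move=> x y z Dx Dy /andP[xz zy]; apply: (iD x y) => //; rewrite !ltW.
have [nz|zn] := leqP (mi_norm n) (size zs).
  by left; exists zs; split => //; apply/allP => z /zsP[].
right; have [n' n'n n'z] := mi_norm_sub _ _ _ zn.
pose S := {j : 'I_s & 'I_(n' j)}.
pose f (t : S) (x : R) := x ^+ tagged t * w (tag t) x.
have n'0 : exists j, n' j != 0%N.
  apply: contrapT => h; move: n'z; rewrite /mi_norm big1 // => j _.
  by apply/eqP/negPn/negP => nj; apply: h; exists j.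
have cf (t : S) : {within D, continuous (f t)}.
  apply/subspace_continuousP => x Dx; apply: cvgM.
    by apply: cvg_within_filter; exact: exprn_continuous.
  by have /subspace_continuousP := cw (tag t); apply.
have [||c cP] := chebyshev_sign_pattern _ D (fun i => f (enum_val i)) zs iD
    (fun i => cf _) (fun c y => chebyshev_unisolvent _ _ _ c y (ch n' n'0)) _ u.
- by rewrite card_mi n'z.
- by move=> z /zsP[].
have mD : measurable (D : set (measurableTypeR R)).
  exact: is_interval_measurable.
have mw j : measurable_fun (D : set (measurableTypeR R)) (w j).
  exact: (@subspace_continuous_measurable_fun R D (w j) mD (cw j)).
(* Each summand integrates over [D] to a multiple of an orthogonality relation of [T], since [n'] is
   at most [n] in every entry. *)
pose g i x := a * c i * ((T * 'X^(tagged (enum_val i))).[x] *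
  w (tag (enum_val i : S)) x).
pose G x := \sum_i g i x.
have GE x : G x = a * T.[x] * \sum_i c i * f (enum_val i) x.
  rewrite mulr_sumr; apply: eq_bigr => i _.
  by rewrite /g /f hornerM hornerXn; ring.
have [iG G0] : m.-integrable D (fun x : R => (G x)%:E) /\
    \int[m]_(x in D) G x = 0.
  apply: Rintegral_sum_eq0 => // i.
  rewrite /g; set P := T * _;
      have iP : (mu (tag (enum_val i : S))).-integrable setT
      (EFin \o (horner P)) by exact: integrable_poly.
  have w0 x : D x -> 0 <= w (tag (enum_val i : S)) x by move=> /wpos/ltW.
  have [h1 h2] := integrable_density _ _ _ _ _ _ _ mD (mw _) w0
    (muE (tag (enum_val i))) _ iP.
  split; first exact: (integrableZl _ _ h1).
  rewrite RintegralZl // -h2; suff -> : \int[mu (tag (enum_val i))]_x P.[x] = 0.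
    by rewrite mulr0.
  rewrite /P -hornerMXn; apply: oT; apply: leq_trans (n'n _).
  exact: ltn_ord.
set q := \prod_(z <- zs) ('X - z%:P) in aP cP.
have Gpos x : D x -> 0 <= G x.
  move=> Dx; rewrite GE; have [xz|xz] := boolP (x \in zs).
    by have [_ /mup_odd_root/rootP ->] := zsP x xz; rewrite mulr0 mul0r.
  have := cP x Dx xz; set F := \sum_i _ => Fq.
  have q0 : q.[x] != 0 by apply: contraTneq Fq => ->; rewrite mulr0 ltxx.
  have q2 : 0 < q.[x] ^+ 2 by rewrite exprn_even_gt0.
  (* Multiplying by the positive [q(x)^2] splits [G] into two factors of known sign, [a T q] and
     [F q]. *)
  rewrite -(pmulr_lge0 _ q2).
  have -> : a * T.[x] * F * q.[x] ^+ 2 = (a * (T * q).[x]) * (F * q.[x]).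
    by rewrite hornerM; ring.
  by rewrite mulr_ge0 ?aP // ltW.
have mG : measurable_fun (D : set (measurableTypeR R)) (fun x : R => (G x)%:E).
  exact: (measurable_int _ iG).
have iGabs : (\int[m]_(x in D) `|(G x)%:E|)%E = 0%E.
  rewrite (eq_integral (fun x : measurableTypeR R => (G x)%:E)); last first.
    by move=> x /[!inE] Dx; rewrite /= ger0_norm // Gpos.
  by rewrite -(fineK (integrable_fin_num _ iG)) //; rewrite /Rintegral in G0;
      rewrite G0.
have /(ae_eq_integral_abs _ mD mG) aeG := iGabs.
pose U := [set x : R | ~~ root T x].
have oU : open U := open_nonroots T.
have mU : measurable (U : set (measurableTypeR R)).
  exact: open_measurable.
have mU0 : m (U `&` D) = 0%E.
  apply/(@negligibleP _ (measurableTypeR R)); first exact: measurableI.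
  apply: (@negligibleS _ (measurableTypeR R) _ m) aeG => x /= [Ux Dx] /(_ Dx).
  move=> [] /eqP; rewrite GE !mulf_eq0 (negPf a0) -rootE (negPf Ux) /=.
  apply/negP; have xz : x \notin zs.
    by apply: contra Ux => /zsP[_ /mup_odd_root].
  by have := cP x Dx xz; apply: contraTneq => ->; rewrite mul0r ltxx.
move=> j x sx; apply: contrapT => /negP rx.
apply: (@open_support_pos _ (mu j) U x) => //.
apply: (proj2 (@negligibleP _ (measurableTypeR R) _ (mu j) U mU)).
apply: etrans (muE j U mU) _.
rewrite (eq_integral (fun x : measurableTypeR R => `|(w j x)%:E|)%E);
    last first.
  by move=> y /[!inE] -[_ Dy]; rewrite /= gtr0_norm // wpos.
apply: integral_abs_eq0 => //; first exact: measurableI.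
by apply/measurable_EFinP; apply: measurable_funS (mw j).
Qed.

Lemma card_le_roots (T : {poly R}) (A : set R) n :
  (`I_n #<= A)%card -> (forall x, A x -> root T x) ->
  exists rs, [/\ uniq rs, all (root T) rs & size rs = n].
Proof.
move=> /card_le_seq[rs [u srs rsA]] AT; exists rs; split => //.
by apply/allP => x /rsA /AT.
Qed.

Lemma AT_many_zeros s (mu : 'I_s -> meas) n :
  (forall j, finite_moments (mu j)) -> (forall j, msupp (mu j) !=set0) ->
  AT_system mu -> indices mu n -> many_zeros (system mu) n.
Proof.
move=> fm sne at_mu [_ nU] T T0 oT.
have [[zs [u nz o]]|sT] := AT_odd_roots _ _ _ _ fm sne at_mu T0 oT.
  exists zs; split => //; apply: sub_all o => z; exact: mup_odd_root.
have [rs [u rr srs]] := card_le_roots T _ _ nU ltac:(by move=> x [j _ /sT]).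
by exists rs; split => //; rewrite srs.
Qed.

(** If [T] vanishes on all supports, their union provides [mi_norm n + 1] distinct zeros, because
    [mi_succ n j] is an index. *)
Lemma AT_many_odd_zeros s (mu : 'I_s -> meas) n j :
  (forall j, finite_moments (mu j)) -> (forall j, msupp (mu j) !=set0) ->
  AT_system mu -> indices mu (mi_succ n j) -> many_odd_zeros (system mu) n.
Proof.
move=> fm sne at_mu [_ nU] T T0 oT.
have [[zs [u nz o]]|sT] := AT_odd_roots _ _ _ _ fm sne at_mu T0 oT.
  by exists zs => //; left.
have [rs [u rr srs]] := card_le_roots T _ _ nU ltac:(by move=> x [i _ /sT]).
by exists rs => //; right; rewrite srs mi_norm_succ.
Qed.

End ATSystems.

Theorem mainTheorem14 (R : realType) (s : nat)
    (mu : 'I_s -> {measure set (measurableTypeR R) -> \bar R}) (z0 : R) :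
  (0 < s)%N ->
  (forall j, finite_moments (mu j)) ->
  (forall j, msupp (mu j) !=set0) ->
  angelesco mu \/ AT_system mu ->
  (forall k, normal_index (system mu) k ->
     ~~ root (typeII_poly (system mu) k) z0) ->
  [/\ perfect (indices mu) (christoffel mu z0),
      forall k, indices mu k -> real_rooted (typeII_poly (christoffel mu z0) k)
    & forall k j, indices mu k -> indices mu (mi_succ k j) ->
        (forall i, ~~ saturated mu k i) ->
        interlace (('X - z0%:P) * typeII_poly (christoffel mu z0) k)
                  (typeII_poly (system mu) k) /\
        interlace (('X - z0%:P) * typeII_poly (christoffel mu z0) k)
                  (typeII_poly (system mu) (mi_succ k j))].
Proof.
move=> _ fm sne sys nz.
have lin := system_linear _ _ fm.
have LL' := christoffel_system _ mu z0.
have mz k : indices mu k -> many_zeros (system mu) k.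
  by move=> kI; case: sys => h; [apply: angelesco_many_zeros; case: kI
                                |exact: AT_many_zeros].
have nn k : indices mu k -> normal_index (system mu) k.
  by move=> /mz; exact: normal_many_zeros.
have nn' k : indices mu k -> normal_index (christoffel mu z0) k.
  by move=> /nn kn; apply: (christoffel_normal _ _ _ lin LL') => //; exact: nz.
split=> // [k kI|k j kI kjI ns].
  by apply: (christoffel_real_rooted _ _ _ lin LL'); [exact: mz|exact: nn'].
have moz : many_odd_zeros (system mu) k.
  case: sys => h; last exact: AT_many_odd_zeros kjI.
  by apply: angelesco_many_odd_zeros => //; case: kI.
have [_ [sP oP]] := typeII_polyP _ _ lin (nn _ kI).
have [_ [sPj oPj]] := typeII_polyP _ _ lin (nn _ kjI).
(* Both relations are applied at the index [k]: the polynomial of [mi_succ k j] is orthogonal for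
   [k] too, and its degree is at most [mi_norm k + 1]. *)
split; apply: (christoffel_interlace _ _ _ lin LL') => //.
- exact: nn'.
- exact: leq_trans sP _.
- exact/nz/nn.
- exact: nn'.
- by apply: orthogonal_le oPj => i; rewrite leq_addr.
- by rewrite -(mi_norm_succ _ j).
- exact/nz/nn.
Qed.
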